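(* Let $n\ge1$ and let $\Lambda$ be an $n$-representation-finite algebra. Then every cluster-root of $\Lambda$ is $\Phi$-sign-coherent. Moreover, if $n$ is even, then every cluster-root of $\Lambda$ is $\Phi$-positive.
   Context: Conventions: $K$ is an algebraically closed field. All algebras are basic, indecomposable (connected) and finite dimensional over $K$; modules are finitely generated right modules. $\Lambda=KQ/(R)$ with $Q$ a finite connected acyclic quiver with vertices $1,\dots,l$ and idempotents $e_1,\dots,e_l$. $\Lambda$ is $n$-representation-finite if $\mathrm{gl.dim}\,\Lambda\le n$ and there is an $n$-cluster tilting module $M$: $\mathrm{add}\,M=\{X\mid \mathrm{Ext}^i_\Lambda(M,X)=0,\ 0<i<n\}=\{X\mid \mathrm{Ext}^i_\Lambda(X,M)=0,\ 0<i<n\}$ ($\mathrm{add}\,M$ is unique). A module is cluster-indecomposable if it is isomorphic to an indecomposable direct summand of $M$. A cluster-root of $\Lambda$ is a vector of the form $\underline{\dim}X=(\dim_K Xe_1,\dots,\dim_K Xe_l)\in\mathbb{Z}^l$ (a column vector) with $X$ cluster-indecomposable. The Cartan matrix $C_\Lambda$ has $(i,j)$ entry $\dim_K(e_j\Lambda e_i)$, and the Coxeter transformation is $\Phi=(-1)^nC_\Lambda^tC_\Lambda^{-1}$, acting on $\mathbb{Z}^l$. A vector $x\in\mathbb{Z}^l$ is $\Phi$-sign-coherent if for every $m\in\mathbb{Z}$ one has $\Phi^m(x)\in\mathbb{Z}^l_{\ge0}$ or $\Phi^m(x)\in\mathbb{Z}^l_{\le0}$; it is $\Phi$-positive if $\Phi^m(x)\in\mathbb{Z}^l_{\ge0}$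 for every $m\in\mathbb{Z}$. *)

(* Defs.v *)
From HB Require Import structures.
From mathcomp Require Import all_boot all_order all_algebra all_field.

Set Implicit Arguments.
Unset Strict Implicit.
Unset Printing Implicit Defensive.

Import Order.TTheory GRing.Theory Num.Theory.
Local Open Scope ring_scope.

Record quiver (l : nat) := Quiver {
  arrow : finType;
  src : arrow -> 'I_l;
  tgt : arrow -> 'I_l }.

Section Quivers.
Variables (l : nat) (Q : quiver l).

(* A path is encoded by its starting vertex and the sequence of its arrows, in
   the order in which they are travelled; (i, [::]) is the trivial path at i. *)
Definition qpath : Type := ('I_l * seq (arrow Q))%type.

Fixpoint walk (i : 'I_l) (s : seq (arrow Q)) : bool :=
  if s is x :: s' then (src x == i) && walk (tgt x) s' else true.

Definition is_path (p : qpath) : bool := walk p.1 p.2.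

Definition path_end (p : qpath) : 'I_l := last p.1 (map (@tgt l Q) p.2).

Definition acyclic_quiver : Prop :=
  forall p : qpath, is_path p -> path_end p = p.1 -> p.2 = [::].

Definition quiver_adj : rel 'I_l :=
  fun i j => [exists x : arrow Q, ((src x == i) && (tgt x == j))
                               || ((src x == j) && (tgt x == i))].

Definition connected_quiver : Prop :=
  (0 < l)%N /\ forall i j : 'I_l, connect quiver_adj i j.

End Quivers.

Section BoundQuiverAlgebra.
Variables (K : fieldType) (l : nat) (Q : quiver l) (A : falgType K).
Variables (e : 'I_l -> A) (a : arrow Q -> A).

Definition path_image (p : qpath Q) : A := e p.1 * \prod_(x <- p.2) a x.

(* The algebra A is KQ/I for an admissible ideal I, the classes of the trivial
   paths and of the arrows being e and a.  The product of KQ is concatenation,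
   p q being "p, then q".  The first three fields say that e and a induce a
   unital algebra morphism pi : KQ -> A, whose value at a path p is
   path_image p; bqa_surj says that pi is onto, and the last two fields that
   I := ker pi satisfies J^N <= I <= J^2, with J the arrow ideal of KQ.  An
   element of KQ is given as a linear combination of a duplicate-free sequence
   of paths. *)
Record bound_quiver_algebra : Prop := BoundQuiverAlgebra {
  bqa_orth : forall i j, e i * e j = if i == j then e i else 0;
  bqa_unit : \sum_i e i = 1;
  bqa_arrow : forall x : arrow Q, e (src x) * a x * e (tgt x) = a x;
  bqa_surj : forall z : A, exists (s : seq (qpath Q)) (c : qpath Q -> K),
    [/\ uniq s, all (@is_path l Q) s & z = \sum_(p <- s) c p *: path_image p];
  bqa_sub_J2 : forall (s : seq (qpath Q)) (c : qpath Q -> K),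
    uniq s -> all (@is_path l Q) s ->
    \sum_(p <- s) c p *: path_image p = 0 ->
    forall p, p \in s -> (size p.2 < 2)%N -> c p = 0;
  bqa_sup_JN : exists N : nat, forall p : qpath Q,
    is_path p -> (N <= size p.2)%N -> path_image p = 0 }.

End BoundQuiverAlgebra.

(* Finite dimensional right modules; x . b is written [ract b x]. *)
Record rmodule (K : fieldType) (A : falgType K) := RModule {
  rmod_sort :> vectType K;
  ract : A -> 'End(rmod_sort);
  ract_linear : linear ract;
  ract1 : forall x, ract 1 x = x;
  ractM : forall b c x, ract (b * c) x = ract c (ract b x) }.

Section Modules.
Variables (K : fieldType) (A : falgType K).
Implicit Types X Y Z M P : rmodule A.

Definition rhom X Y (f : 'Hom(X, Y)) : Prop :=
  forall (b : A) (x : X), f (ract X b x) = ract Y b (f x).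

Definition riso X Y : Prop :=
  exists f : 'Hom(X, Y), [/\ rhom f, lker f = 0%VS & limg f = fullv].

Definition rzero X : Prop := forall x : X, x = 0.

Section DirectSum.
Variables X Y : rmodule A.

Definition rsum_fun (b : A) (u : X * Y) : X * Y :=
  (ract X b u.1, ract Y b u.2).

Fact rsum_fun_linear b : linear (rsum_fun b).
Proof. by move=> k u v; rewrite /rsum_fun /= !linearP. Qed.
HB.instance Definition _ b :=
  GRing.isLinear.Build K (X * Y)%type (X * Y)%type _ (rsum_fun b)
    (rsum_fun_linear b).

Definition rsum_act (b : A) : 'End((X * Y)%type) := linfun (rsum_fun b).

Fact rsum_act_linear : linear rsum_act.
Proof.
move=> k b c; apply/lfunP=> u; rewrite add_lfunE scale_lfunE !lfunE /=.
by rewrite /rsum_fun !ract_linear !add_lfunE !scale_lfunE.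
Qed.

Fact rsum_act1 x : rsum_act 1 x = x.
Proof. by rewrite lfunE /= /rsum_fun !ract1; case: x. Qed.

Fact rsum_actM b c x : rsum_act (b * c) x = rsum_act c (rsum_act b x).
Proof. by rewrite !lfunE /= /rsum_fun !ractM. Qed.

Definition rsum : rmodule A := RModule rsum_act_linear rsum_act1 rsum_actM.

End DirectSum.

Section Power.
Variables (X : rmodule A) (k : nat).

Definition rpow_fun (b : A) (u : {ffun 'I_k -> X}) : {ffun 'I_k -> X} :=
  [ffun i => ract X b (u i)].

Fact rpow_fun_linear b : linear (rpow_fun b).
Proof. by move=> t u v; apply/ffunP=> i; rewrite !ffunE linearP. Qed.
HB.instance Definition _ b :=
  GRing.isLinear.Build K {ffun 'I_k -> X} {ffun 'I_k -> X} _ (rpow_fun b)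
    (rpow_fun_linear b).

Definition rpow_act (b : A) : 'End({ffun 'I_k -> X}) := linfun (rpow_fun b).

Fact rpow_act_linear : linear rpow_act.
Proof.
move=> t b c; apply/lfunP=> u; rewrite add_lfunE scale_lfunE !lfunE /=.
by apply/ffunP=> i; rewrite !ffunE ract_linear add_lfunE scale_lfunE.
Qed.

Fact rpow_act1 x : rpow_act 1 x = x.
Proof. by rewrite lfunE; apply/ffunP=> i; rewrite ffunE ract1. Qed.

Fact rpow_actM b c x : rpow_act (b * c) x = rpow_act c (rpow_act b x).
Proof. by rewrite !lfunE; apply/ffunP=> i; rewrite !ffunE ractM. Qed.

Definition rpow : rmodule A := RModule rpow_act_linear rpow_act1 rpow_actM.

End Power.

Definition summand X Y : Prop := exists Z, riso (rsum X Z) Y.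

Definition in_add M X : Prop := exists k : nat, summand X (rpow M k).

Definition indecomposable X : Prop :=
  ~ rzero X /\ forall Y Z, riso (rsum Y Z) X -> rzero Y \/ rzero Z.

Definition projective P : Prop :=
  forall (X Y : rmodule A) (g : 'Hom(X, Y)) (h : 'Hom(P, Y)),
    rhom g -> limg g = fullv -> rhom h ->
    exists2 h' : 'Hom(P, X), rhom h' & (g \o h')%VF = h.

Record resolution X := Resolution {
  res_mod : nat -> rmodule A;
  res_d : forall k, 'Hom(res_mod k.+1, res_mod k);
  res_aug : 'Hom(res_mod 0, X);
  res_proj : forall k, projective (res_mod k);
  res_d_hom : forall k, rhom (res_d k);
  res_aug_hom : rhom res_aug;
  res_aug_surj : limg res_aug = fullv;
  res_exact0 : limg (res_d 0) = lker res_aug;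
  res_exactS : forall k, limg (res_d k.+1) = lker (res_d k) }.

Definition pdim_le (n : nat) X : Prop :=
  exists P : resolution X, forall k, (n < k)%N -> rzero (res_mod P k).

Definition gldim_le (n : nat) : Prop := forall X, pdim_le n X.

(* The vanishing of the i-th cohomology of the complex Hom(P, Y). *)
Definition hom_exact_at X Y (P : resolution X) (i : nat) : Prop :=
  forall f : 'Hom(res_mod P i, Y), rhom f -> (f \o res_d P i)%VF = 0 ->
  match i return 'Hom(res_mod P i, Y) -> Prop with
  | 0 => fun f => f = 0
  | j.+1 => fun f =>
      exists2 g : 'Hom(res_mod P j, Y), rhom g & f = (g \o res_d P j)%VF
  end f.

(* Ext^i(X, Y) = 0; the choice of the projective resolution is immaterial. *)
Definition Ext_zero (i : nat) X Y : Prop :=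
  exists P : resolution X, hom_exact_at Y P i.

Definition cluster_tilting (n : nat) M : Prop :=
  forall X,
    (in_add M X <-> forall i, (0 < i < n)%N -> Ext_zero i M X) /\
    (in_add M X <-> forall i, (0 < i < n)%N -> Ext_zero i X M).

Definition representation_finite (n : nat) : Prop :=
  gldim_le n /\ exists M, cluster_tilting n M.

Definition cluster_indecomposable (n : nat) X : Prop :=
  exists2 M, cluster_tilting n M & indecomposable X /\ summand X M.

End Modules.

Arguments gldim_le {K} A n.
Arguments representation_finite {K} A n.

Section Coxeter.
Variables (K : fieldType) (l : nat) (A : falgType K) (e : 'I_l -> A) (n : nat).

Definition dimv (X : rmodule A) : 'cV[int]_l :=
  \col_i (\dim (limg (ract X (e i))))%:Z.

Definition cluster_root (x : 'cV[int]_l) : Prop :=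
  exists2 X : rmodule A, cluster_indecomposable n X & x = dimv X.

Definition cartan : 'M[int]_l :=
  \matrix_(i, j) (\dim (<[e j]> * {:A} * <[e i]>))%:Z.

Definition coxeter : 'M[int]_l := (-1) ^+ n *: (cartan^T *m invmx cartan).

End Coxeter.

(* Integer powers; not available in the library when l is not a successor. *)
Definition mxpowz (l : nat) (B : 'M[int]_l) (m : int) : 'M[int]_l :=
  match m with
  | Posz k => iter k (mulmx B) 1%:M
  | Negz k => iter k.+1 (mulmx (invmx B)) 1%:M
  end.

Section SignCoherence.
Variables (l : nat) (Phi : 'M[int]_l).
Implicit Types x : 'cV[int]_l.

Definition nonneg_vec x : Prop := forall i, 0 <= x i 0.
Definition nonpos_vec x : Prop := forall i, x i 0 <= 0.

Definition sign_coherent x : Prop :=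
  forall m : int, nonneg_vec (mxpowz Phi m *m x) \/ nonpos_vec (mxpowz Phi m *m x).

Definition phi_positive x : Prop :=
  forall m : int, nonneg_vec (mxpowz Phi m *m x).

End SignCoherence.

(* Main.v *)
From HB Require Import structures.
From mathcomp Require Import all_boot all_order all_algebra all_field.
From mathcomp Require Import perm zify.
From Stdlib Require Import ClassicalEpsilon.
Require Import Defs.

(** Let X be an indecomposable summand of the cluster tilting module M.

    If X is projective, then [Phi (dim X) = (-1)^n dim (nu X)] with nu the
    Nakayama functor, and nu X is again an indecomposable object of add M.

    Otherwise, augment a projective resolution of X to a complex C with
    [C 0 = X].  The complex Hom(C, A) is exact in the middle by the cluster
    tilting condition, and at X because Hom(X, A) = 0: the image of Hom(X, A)
    in Hom(P_0, A) is an (n+1)-st syzygy of left modules, hence a direct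
    summand.  So the higher translate tau_n X = D Ext^n(X, A) satisfies
    [dim (tau_n X) = Phi (dim X)] by a count of alternating sums, it is
    indecomposable by lifting its idempotent endomorphisms to C, and it lies in
    add M by a diagram chase in the double complex of homomorphisms from C to a
    resolution of M.

    Hence [Phi], up to the sign [(-1)^n], maps the finite set of dimension
    vectors of indecomposable summands of M to itself.  Being injective, it
    permutes this set up to sign, which settles the negative powers as well. *)

Set Implicit Arguments.
Unset Strict Implicit.
Unset Printing Implicit Defensive.

Import Order.TTheory GRing.Theory Num.Theory.
Local Open Scope ring_scope.

(** * Linear functionals *)

(** Only right modules are formed: Hom(P, A) is a vector space of homomorphisms with the left
    multiplications [lscale], and D is the space of linear functionals. The translate is read off
    from the last differential P_n -> P_(n-1) as the kernel of nu P_n -> nu P_(n-1), so everything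
    about it follows from the pairing [ev] of this kernel with Hom(P_n, A). The duality Hom(Z, nu P)
    = D Hom(P, Z) is made explicit by traces over dual bases, which avoids injective resolutions.

    In an augmented complex P_k sits at index k+1; thus [d n] is P_n -> P_(n-1), and [C n.+2] is
    P_(n+1), which vanishes by the bound on the global dimension. Cluster tilting gives Ext^i(X, A)
    = 0 only for 0 < i < n; the vanishing of Hom(X, A) is what leaves a single term in the
    alternating sum.

    Finiteness of the set of dimension vectors comes from a bound by dim M. Since objects of add M
    are summands of powers of M, this needs local endomorphism rings. *)

Definition lfE := (add_lfunE, opp_lfunE, scale_lfunE, comp_lfunE, id_lfunE, zero_lfunE).

Section LinearAlgebra.
Variable K : fieldType.
Implicit Types U V W : vectType K.

Fact lfun_of_subproof U V (f : U -> V) (fL : linear f) : {g : 'Hom(U, V) | g =1 f}.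
Proof.
exists (linfun (HB.pack_for {linear U -> V} f
                  (GRing.isLinear.Build K U V *:%R f fL))) => x.
by rewrite lfunE.
Qed.

Definition lfun_of U V (f : U -> V) (fL : linear f) : 'Hom(U, V) :=
  sval (lfun_of_subproof fL).

Lemma lfun_ofE U V (f : U -> V) (fL : linear f) x : lfun_of fL x = f x.
Proof. exact: svalP (lfun_of_subproof fL) x. Qed.

Lemma lfun_choice U V (R : U -> V -> Prop) :
  (forall x, exists y, R x y) ->
  (forall x y z, R x y -> R x z -> y = z) ->
  (forall k x x' y y', R x y -> R x' y' -> R (k *: x + x') (k *: y + y')) ->
  exists f : 'Hom(U, V), forall x, R x (f x).
Proof.
move=> exR unR linR.
pose f x := proj1_sig (constructive_indefinite_description _ (exR x)).
have fP x : R x (f x) by rewrite /f; case: constructive_indefinite_description.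
have fL : linear f by move=> k x y; apply: unR (fP _) _; apply: linR.
by exists (lfun_of fL) => x; rewrite lfun_ofE.
Qed.

Lemma lfun_factor U V W (T : 'Hom(U, V)) (F : 'Hom(U, W)) :
  (lker T <= lker F)%VS -> forall x, (F \o T^-1)%VF (T x) = F x.
Proof.
move=> /subvP TF x; rewrite comp_lfunE; apply/eqP; rewrite -subr_eq0 -linearB /=.
by rewrite -memv_ker TF // memv_ker linearB /= limg_lfunVK ?subrr ?memv_img ?memvf.
Qed.

(** The hypothesis says that F vanishes on the kernel of the map from U1 to V modulo V1 induced by
    T, so F factors through it. The quotient by V1 is modelled by the projector [\1 - projv V1],
    whose kernel is V1. *)
Lemma functional_ext U V (T : 'Hom(U, V)) (U1 : {vspace U}) (V1 : {vspace V})
    (F : 'Hom(U, K^o)) :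
  (forall x, x \in U1 -> T x \in V1 -> F x = 0) ->
  exists2 G : 'Hom(V, K^o),
    forall y, y \in V1 -> G y = 0 & forall x, x \in U1 -> G (T x) = F x.
Proof.
move=> TF; pose p : 'End(V) := \1%VF - projv V1.
have p0 y : (p y == 0) = (y \in V1).
  rewrite !lfun_simp /= subr_eq0; apply/eqP/idP => [->|/projv_id //].
  exact: memv_proj.
pose i : 'Hom(subvs_of U1, U) := linfun vsval.
have iE u : i u = vsval u by rewrite lfunE.
pose T' := (p \o T \o i)%VF; pose F' := (F \o i)%VF.
have TF' : (lker T' <= lker F')%VS.
  apply/subvP => u; rewrite !memv_ker !comp_lfunE iE => uT.
  by rewrite TF ?subvsP // -p0.
exists (F' \o T'^-1 \o p)%VF => [y yV|x xU].
  by rewrite comp_lfunE; move: yV; rewrite -p0 => /eqP ->; rewrite linear0.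
have -> : x = i (vsproj U1 x) by rewrite iE vsprojK.
by rewrite comp_lfunE; have := lfun_factor TF' (vsproj U1 x);
   rewrite /T' /F' !comp_lfunE => ->.
Qed.

(** If v were outside B, the coefficient functional on the line Kv would extend to a functional on U
    that vanishes on B. *)
Lemma functional_sep U (B : {vspace U}) v :
  (forall xi : 'Hom(U, K^o), (forall y, y \in B -> xi y = 0) -> xi v = 0) -> v \in B.
Proof.
move=> sep; apply/negPn/negP => vB.
have hL : linear (fun k : K^o => k *: v).
  by move=> k x y; rewrite scalerDl scalerA.
have [|G GB G1] := @functional_ext _ _ (lfun_of hL) fullv B \1%VF.
  move=> x _; rewrite lfun_ofE id_lfunE => xB; apply/eqP/negPn/negP => x0.
  by case/negP: vB; rewrite -[v](scalerK x0) memvZ.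
have := G1 1 (memvf _); rewrite lfun_ofE scale1r (sep G GB) id_lfunE.
by move/esym/eqP; rewrite oner_eq0.
Qed.

Lemma bidual_eval U (L : 'Hom('Hom(U, K^o), K^o)) : exists v, forall xi, L xi = xi v.
Proof.
pose b := vbasis {:U}.
have cL i : linear (coord b i : U -> K^o) by move=> k x y; rewrite linearP.
exists (\sum_(i < \dim {:U}) L (lfun_of (cL i)) *: b`_i) => xi.
have {1}-> : xi = \sum_(i < \dim {:U}) xi b`_i *: lfun_of (cL i).
  apply/lfunP => x; rewrite sum_lfunE {1}(coord_vbasis (memvf x)) linear_sum.
  by apply: eq_bigr => i _; rewrite linearZ scale_lfunE lfun_ofE /= [RHS]mulrC.
rewrite !linear_sum; apply: eq_bigr => i _.
by rewrite !linearZ /= [RHS]mulrC.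
Qed.
End LinearAlgebra.

(** * Homomorphisms, submodules and dual bases *)

Section ModuleMaps.
Variables (K : fieldType) (A : falgType K).
Implicit Types X Y Z P : rmodule A.

Lemma ractDl X b c (x : X) : ract X (b + c) x = ract X b x + ract X c x.
Proof. by have := ract_linear X 1 b c; rewrite !scale1r => ->; rewrite add_lfunE. Qed.

Lemma ractZl X k b (x : X) : ract X (k *: b) x = k *: ract X b x.
Proof.
have R0 : ract X 0 = 0.
  by apply: (addIr (ract X 0)); rewrite add0r -{1}[ract X 0]scale1r -ract_linear scale1r add0r.
by have := ract_linear X k b 0; rewrite addr0 R0 addr0 => ->; rewrite scale_lfunE.
Qed.

Lemma ract0 X (x : X) : ract X 0 x = 0.
Proof. by rewrite -(scale0r 0) ractZl scale0r. Qed.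

Lemma ract_sum X I (r : seq I) (p : pred I) (F : I -> A) (x : X) :
  ract X (\sum_(i <- r | p i) F i) x = \sum_(i <- r | p i) ract X (F i) x.
Proof.
elim/big_rec2: _ => [|i c d _ <-]; first exact: ract0.
exact: ractDl.
Qed.

Lemma rhom0 X Y : rhom (0 : 'Hom(X, Y)).
Proof. by move=> b x; rewrite !lfunE /= linear0. Qed.

Lemma rhom1 X : rhom (\1%VF : 'Hom(X, X)).
Proof. by move=> b x; rewrite !lfunE. Qed.

Lemma rhomD X Y (f g : 'Hom(X, Y)) : rhom f -> rhom g -> rhom (f + g).
Proof. by move=> fh gh b x; rewrite !add_lfunE fh gh linearD. Qed.

Lemma rhomN X Y (f : 'Hom(X, Y)) : rhom f -> rhom (- f).
Proof. by move=> fh b x; rewrite !opp_lfunE fh linearN. Qed.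

Lemma rhomB X Y (f g : 'Hom(X, Y)) : rhom f -> rhom g -> rhom (f - g).
Proof. by move=> fh gh; apply: rhomD => //; apply: rhomN. Qed.

Lemma rhomZ X Y k (f : 'Hom(X, Y)) : rhom f -> rhom (k *: f).
Proof. by move=> fh b x; rewrite !scale_lfunE fh linearZ. Qed.

Lemma rhom_comp X Y Z (g : 'Hom(Y, Z)) (f : 'Hom(X, Y)) :
  rhom g -> rhom f -> rhom (g \o f)%VF.
Proof. by move=> gh fh b x; rewrite !comp_lfunE fh gh. Qed.

Lemma rhom_sum X Y I (r : seq I) (p : pred I) (F : I -> 'Hom(X, Y)) :
  (forall i, p i -> rhom (F i)) -> rhom (\sum_(i <- r | p i) F i).
Proof.
by move=> Fh; elim/big_rec: _ => [|i f pi fh]; [apply: rhom0 | apply: rhomD; auto].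
Qed.

Lemma hom_defect_linear X Y b :
  linear (fun f : 'Hom(X, Y) => (f \o ract X b)%VF - (ract Y b \o f)%VF).
Proof.
move=> k f g; apply/lfunP => x.
by rewrite !lfE linearD linearZ /= scalerBr opprD addrACA.
Qed.

(** Commuting with a basis of A suffices, so the homomorphisms form a finite intersection of
    kernels, hence a subspace with a dimension and a dual. *)
Definition homv X Y : {vspace 'Hom(X, Y)} :=
  (\bigcap_(i < \dim {:A}) lker (lfun_of (@hom_defect_linear X Y (vbasis {:A})`_i)))%VS.

Lemma homvP X Y (f : 'Hom(X, Y)) : reflect (rhom f) (f \in homv X Y).
Proof.
apply: (iffP idP) => [fH b x|fh]; last first.
  rewrite memvE; apply/subv_bigcapP => i _; rewrite -memvE memv_ker lfun_ofE.
  by rewrite subr_eq0; apply/eqP/lfunP => x; rewrite !comp_lfunE fh.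
rewrite (coord_vbasis (memvf b)) !ract_sum linear_sum; apply: eq_bigr => i _.
rewrite !ractZl linearZ; congr (_ *: _).
have: f \in lker (lfun_of (@hom_defect_linear X Y (vbasis {:A})`_i)).
  by move: fH; rewrite memvE => /subv_bigcapP/(_ i isT); rewrite -memvE.
rewrite memv_ker lfun_ofE subr_eq0 => /eqP/lfunP/(_ x).
by rewrite !comp_lfunE.
Qed.

Section Submodule.
Variables (X : rmodule A) (U : {vspace X}).
Hypothesis Ust : forall b x, x \in U -> ract X b x \in U.

Definition subv_incl : 'Hom(subvs_of U, X) := linfun vsval.
Definition subv_proj : 'Hom(X, subvs_of U) := linfun (vsproj U).

Lemma subv_inclE u : subv_incl u = vsval u. Proof. exact: lfunE. Qed.
Lemma subv_projE x : subv_proj x = vsproj U x. Proof. exact: lfunE. Qed.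

Definition rsub_act (b : A) : 'End(subvs_of U) :=
  (subv_proj \o ract X b \o subv_incl)%VF.

Lemma val_rsub_act b u : vsval (rsub_act b u) = ract X b (vsval u).
Proof.
by rewrite !comp_lfunE subv_inclE subv_projE vsprojK // Ust ?subvsP.
Qed.

Fact rsub_act_linear : linear rsub_act.
Proof.
move=> k b c; apply/lfunP => u; apply: subvs_inj.
rewrite val_rsub_act add_lfunE scale_lfunE linearP /= !val_rsub_act.
by rewrite ractDl ractZl.
Qed.

Fact rsub_act1 u : rsub_act 1 u = u.
Proof. by apply: subvs_inj; rewrite val_rsub_act ract1. Qed.

Fact rsub_actM b c u : rsub_act (b * c) u = rsub_act c (rsub_act b u).
Proof. by apply: subvs_inj; rewrite !val_rsub_act ractM. Qed.

Definition rsub : rmodule A := RModule rsub_act_linear rsub_act1 rsub_actM.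

Definition rsub_incl : 'Hom(rsub, X) := subv_incl.

Lemma rsub_incl_hom : rhom rsub_incl.
Proof. by move=> b u; rewrite [LHS]subv_inclE val_rsub_act [in RHS]subv_inclE. Qed.

Lemma rsub_incl_inj : injective rsub_incl.
Proof. by move=> u v; rewrite [LHS]subv_inclE [RHS]subv_inclE => /subvs_inj. Qed.

Lemma rsub_incl_mem u : rsub_incl u \in U.
Proof. by rewrite [rsub_incl u]subv_inclE subvsP. Qed.

Lemma rsub_lift x : x \in U -> exists u, rsub_incl u = x.
Proof. by move=> xU; exists (vsproj U x); rewrite [LHS]subv_inclE vsprojK. Qed.

Lemma rsub_corestrict Z (f : 'Hom(Z, X)) : rhom f -> (forall z, f z \in U) ->
  exists2 g : 'Hom(Z, rsub), rhom g & forall z, rsub_incl (g z) = f z.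
Proof.
move=> fh fU; exists (subv_proj \o f)%VF => [b z|z]; last first.
  by rewrite [LHS]subv_inclE comp_lfunE subv_projE vsprojK.
apply: rsub_incl_inj; rewrite rsub_incl_hom ![rsub_incl _]subv_inclE.
by rewrite !comp_lfunE !subv_projE !vsprojK ?fh ?Ust.
Qed.

End Submodule.

Lemma lker_stable X Y (f : 'Hom(X, Y)) : rhom f ->
  forall b x, x \in lker f -> ract X b x \in lker f.
Proof. by move=> fh b x; rewrite !memv_ker fh => /eqP ->; rewrite linear0. Qed.

Lemma limg_stable X Y (f : 'Hom(X, Y)) : rhom f ->
  forall b x, x \in limg f -> ract Y b x \in limg f.
Proof. by move=> fh b _ /memv_imgP[x _ ->]; rewrite -fh memv_img ?memvf. Qed.

(** [projective] speaks of surjections only; both maps are corestricted to the image of g. *)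
Lemma proj_lift P X Y (g : 'Hom(X, Y)) (h : 'Hom(P, Y)) :
  projective P -> rhom g -> rhom h -> (forall p, h p \in limg g) ->
  exists2 h' : 'Hom(P, X), rhom h' & forall p, g (h' p) = h p.
Proof.
move=> Pp gh hh hg.
have [g1 g1h g1E] := rsub_corestrict (limg_stable gh) gh (fun x => memv_img g (memvf x)).
have [h1 h1h h1E] := rsub_corestrict (limg_stable gh) hh hg.
have [|h' h'h h'E] := Pp _ _ g1 h1 g1h _ h1h.
  apply/eqP; rewrite eqEsubv subvf /=; apply/subvP => u _.
  have /memv_imgP[x _ xE] := @rsub_incl_mem _ _ (limg_stable gh) u.
  apply/memv_imgP; exists x; rewrite ?memvf //.
  by apply: (@rsub_incl_inj _ _ (limg_stable gh)); rewrite g1E.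
exists h' => // p; rewrite -g1E -h1E; congr (rsub_incl _ _).
by rewrite -h'E comp_lfunE.
Qed.

Lemma epi_factor X Y Z (g : 'Hom(X, Y)) (f : 'Hom(X, Z)) :
  rhom g -> rhom f -> limg g = fullv -> (forall x, g x = 0 -> f x = 0) ->
  exists2 h : 'Hom(Y, Z), rhom h & forall x, h (g x) = f x.
Proof.
move=> gh fh gs gf.
have kgf : (lker g <= lker f)%VS.
  by apply/subvP => x; rewrite !memv_ker => /eqP/gf ->.
exists (f \o g^-1)%VF; last exact: lfun_factor.
move=> b y; have /memv_imgP[x _ ->] : y \in limg g by rewrite gs memvf.
by rewrite -gh !lfun_factor.
Qed.

Definition reg_act (b : A) : 'End(A) := amulr b.
Fact reg_act_linear : linear reg_act. Proof. exact: amulr_is_linear. Qed.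
Lemma reg_actE (b x : A) : reg_act b x = x * b. Proof. by rewrite lfunE. Qed.
Fact reg_act1 x : reg_act 1 x = x. Proof. by rewrite reg_actE mulr1. Qed.
Fact reg_actM b c x : reg_act (b * c) x = reg_act c (reg_act b x).
Proof. by rewrite !reg_actE mulrA. Qed.
Definition reg : rmodule A := RModule reg_act_linear reg_act1 reg_actM.

Lemma reg_ractE (b : A) (x : reg) : ract reg b x = (x : A) * b.
Proof. exact: reg_actE. Qed.

Lemma outer_linear P Z (phi : 'Hom(P, reg)) (z : Z) :
  linear (fun p : P => ract Z (phi p) z).
Proof. by move=> k p q; rewrite linearP ractDl ractZl. Qed.

(** The rank-one map p |-> z phi(p). Sums of these exhaust Hom(P, Z) as soon as P or Z has a dual
    basis. *)
Definition outer P Z (z : Z) (phi : 'Hom(P, reg)) : 'Hom(P, Z) :=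
  lfun_of (outer_linear phi z).

Lemma outerE P Z (z : Z) (phi : 'Hom(P, reg)) p : outer z phi p = ract Z (phi p) z.
Proof. exact: lfun_ofE. Qed.

Lemma rhom_outer P Z (z : Z) (phi : 'Hom(P, reg)) : rhom phi -> rhom (outer z phi).
Proof. by move=> ph b p; rewrite !outerE ph reg_ractE ractM. Qed.

Lemma lscale_linear P (b : A) (phi : 'Hom(P, reg)) :
  linear (fun p : P => b * (phi p : A) : reg).
Proof. by move=> k p q; rewrite linearP mulrDr scalerAr. Qed.

Definition lscale P (b : A) (phi : 'Hom(P, reg)) : 'Hom(P, reg) :=
  lfun_of (lscale_linear b phi).

Lemma lscaleE P b (phi : 'Hom(P, reg)) p : lscale b phi p = b * (phi p : A).
Proof. exact: lfun_ofE. Qed.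

Lemma rhom_lscale P b (phi : 'Hom(P, reg)) : rhom phi -> rhom (lscale b phi).
Proof. by move=> ph c p; rewrite !lscaleE ph !reg_ractE mulrA. Qed.

Lemma reg_hom_projective : projective reg.
Proof.
move=> X Y g h gh gs hh.
have /memv_imgP[x _ xE] : h (1 : A) \in limg g by rewrite gs memvf.
have L : linear (fun a : reg => ract X a x) by move=> k a b; rewrite ractDl ractZl.
exists (lfun_of L) => [b a|]; first by rewrite !lfun_ofE reg_ractE ractM.
apply/lfunP => a; rewrite comp_lfunE lfun_ofE gh -xE -hh reg_ractE.
by rewrite mul1r.
Qed.

Definition dual_basis P m (p : 'I_m -> P) (phi : 'I_m -> 'Hom(P, reg)) : Prop :=
  (forall i, rhom (phi i)) /\ forall x, x = \sum_i ract P (phi i x) (p i).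

(** A vector space basis of P gives a surjection A^m -> P; the phi_i are the coordinates of a
    section. *)
Lemma dual_basis_exists P : projective P -> exists m p phi, @dual_basis P m p phi.
Proof.
move=> Pp; pose m := \dim {:P}; pose b i : P := (vbasis {:P})`_(i : 'I_m).
have sL : linear (fun c : rpow reg m => \sum_i ract P (c i) (b i)).
  move=> k c d; rewrite scaler_sumr -big_split; apply: eq_bigr => i _ /=.
  by rewrite !ffunE ractDl ractZl.
pose s : 'Hom(rpow reg m, P) := lfun_of sL.
have sh : rhom s.
  move=> a c; rewrite !lfun_ofE linear_sum; apply: eq_bigr => i _.
  by rewrite [ract (rpow _ _) _ _]lfunE ffunE reg_ractE ractM.
have ss : limg s = fullv.
  apply/eqP; rewrite eqEsubv subvf; apply/subvP => x _; apply/memv_imgP.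
  pose c : rpow reg m := [ffun i => (coord (vbasis {:P}) i x)%:A].
  exists c; rewrite ?memvf //.
  rewrite lfun_ofE {1}(coord_vbasis (memvf x)); apply: eq_bigr => i _.
  by rewrite ffunE ractZl ract1.
have [t th tE] := Pp _ _ s \1%VF sh ss (@rhom1 P).
have pL i : linear (fun c : rpow reg m => (c i : reg)) by move=> k c d; rewrite !ffunE.
exists m, b, (fun i => (lfun_of (pL i) \o t)%VF); split=> [i a x|x].
  by rewrite !comp_lfunE !lfun_ofE th [ract (rpow _ _) _ _]lfunE ffunE.
have: x = s (t x) by rewrite -comp_lfunE tE id_lfunE.
rewrite lfun_ofE => {1}->; apply: eq_bigr => i _.
by rewrite comp_lfunE lfun_ofE.
Qed.

Lemma dual_basis_hom P Z m p phi (h : 'Hom(P, Z)) : @dual_basis P m p phi ->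
  rhom h -> forall x, h x = \sum_i ract Z (phi i x) (h (p i)).
Proof.
move=> [_ pE] hh x; rewrite {1}(pE x) linear_sum; apply: eq_bigr => i _.
exact: hh.
Qed.

End ModuleMaps.

(** * The transpose D Coker Hom(d, A) of a homomorphism d *)

Section Transpose.
Variables (K : fieldType) (A : falgType K).
Implicit Types X Y Z P : rmodule A.
Notation reg := (reg A).
Notation dual X := (subvs_of (homv X reg)).

Fact dual_lmul_linear X (b : A) :
  linear (fun u : dual X => vsproj (homv X reg) (lscale b (vsval u))).
Proof.
move=> k u v; rewrite -linearP; congr (vsproj _ _); apply/lfunP => x.
by rewrite !lfE !lscaleE linearP !lfE mulrDr scalerAr.
Qed.
Definition dual_lmul X b : 'End(dual X) := lfun_of (@dual_lmul_linear X b).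

Lemma val_dual_lmul X b u : vsval (dual_lmul X b u) = lscale b (vsval u).
Proof. by rewrite lfun_ofE vsprojK //; apply/homvP/rhom_lscale/homvP/subvsP. Qed.

Fact nu_act_fun_linear X (b : A) :
  linear (fun xi : 'Hom(dual X, K^o) => (xi \o dual_lmul X b)%VF).
Proof. by move=> k u v; apply/lfunP => x; rewrite !lfE. Qed.
Definition nu_act X b : 'End('Hom(dual X, K^o)) := lfun_of (@nu_act_fun_linear X b).

Lemma nu_actE X b xi u : nu_act X b xi u = xi (dual_lmul X b u).
Proof. by rewrite lfun_ofE comp_lfunE. Qed.

Fact nu_act_linear X : linear (@nu_act X).
Proof.
move=> k b c; apply/lfunP => xi; apply/lfunP => u.
rewrite !lfE !nu_actE -linearP; congr (xi _); apply: subvs_inj.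
rewrite val_dual_lmul linearP /= !val_dual_lmul; apply/lfunP => x.
by rewrite !lfE !lscaleE mulrDl scalerAl.
Qed.

Fact nu_act1 X xi : nu_act X 1 xi = xi.
Proof.
apply/lfunP => u; rewrite nu_actE; congr (xi _); apply: subvs_inj.
by rewrite val_dual_lmul; apply/lfunP => x; rewrite lscaleE mul1r.
Qed.

Fact nu_actM X b c xi : nu_act X (b * c) xi = nu_act X c (nu_act X b xi).
Proof.
apply/lfunP => u; rewrite !nu_actE; congr (xi _); apply: subvs_inj.
by rewrite !val_dual_lmul; apply/lfunP => x; rewrite !lscaleE mulrA.
Qed.

(** D Hom(X, A): left multiplication on Hom(X, A) becomes a right action on functionals. *)
Definition nu X : rmodule A := RModule (@nu_act_linear X) (@nu_act1 X) (@nu_actM X).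

Section Tau.
Variables (P P' : rmodule A) (d : 'Hom(P, P')).
Hypothesis dh : rhom d.

Fact dual_pre_linear :
  linear (fun u : dual P' => vsproj (homv P reg) (vsval u \o d)%VF).
Proof.
move=> k u v; rewrite -linearP; congr (vsproj _ _); apply/lfunP => x.
by rewrite !lfE.
Qed.
Definition dual_pre : 'Hom(dual P', dual P) := lfun_of dual_pre_linear.

Lemma val_dual_pre u : vsval (dual_pre u) = (vsval u \o d)%VF.
Proof.
by rewrite lfun_ofE vsprojK //; apply/homvP/rhom_comp => //; apply/homvP/subvsP.
Qed.

Fact nu_map_linear :
  linear (fun xi : nu P => (xi : 'Hom(dual P, K^o)) \o dual_pre : nu P')%VF.
Proof. by move=> k u v; apply/lfunP => x; rewrite !lfE. Qed.
Definition nu_map : 'Hom(nu P, nu P') := lfun_of nu_map_linear.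

Lemma nu_mapE (xi : nu P) u : (nu_map xi : 'Hom(_, _)) u = (xi : 'Hom(_, _)) (dual_pre u).
Proof. by rewrite lfun_ofE comp_lfunE. Qed.

Lemma nu_map_hom : rhom nu_map.
Proof.
move=> b xi; apply/lfunP => u; rewrite [LHS]nu_mapE [LHS]nu_actE [RHS]nu_actE nu_mapE.
congr ((xi : 'Hom(_, _)) _); apply: subvs_inj.
rewrite val_dual_lmul !val_dual_pre val_dual_lmul.
by apply/lfunP => x; rewrite lfE !lscaleE lfE.
Qed.

Definition tau : rmodule A := rsub (lker_stable nu_map_hom).

(* [vsproj] is only meaningful on homomorphisms [phi]. *)
Definition ev (xi : tau) (phi : 'Hom(P, reg)) : K :=
  (rsub_incl (lker_stable nu_map_hom) xi : 'Hom(_, _)) (vsproj (homv P reg) phi).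

Lemma ev_linear_l phi : linear (fun xi : tau => ev xi phi : K^o).
Proof. by move=> k u v; rewrite /ev linearP !lfE. Qed.

Lemma ev_linear_r xi : linear (fun phi => ev xi phi : K^o).
Proof. by move=> k u v; rewrite /ev !linearP. Qed.

Lemma ev_sum xi I (r : seq I) (p : pred I) F :
  ev xi (\sum_(i <- r | p i) F i) = \sum_(i <- r | p i) ev xi (F i).
Proof. by rewrite /ev !linear_sum. Qed.

Lemma ev_suml phi I (r : seq I) (p : pred I) F :
  ev (\sum_(i <- r | p i) F i) phi = \sum_(i <- r | p i) ev (F i) phi.
Proof. by rewrite /ev linear_sum sum_lfunE. Qed.

Lemma ev_act b xi phi : rhom phi -> ev (ract tau b xi) phi = ev xi (lscale b phi).
Proof.
move=> ph; rewrite /ev rsub_incl_hom [LHS]nu_actE; apply: congr1.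
apply: subvs_inj; rewrite val_dual_lmul !vsprojK //; apply/homvP => //.
exact: rhom_lscale.
Qed.

Lemma ev_pre xi phi : rhom phi -> ev xi (phi \o d)%VF = 0.
Proof.
move=> ph; have := rsub_incl_mem xi; rewrite memv_ker => /eqP/lfunP/(_ (vsproj _ phi)).
rewrite nu_mapE zero_lfunE => <-; rewrite /ev; apply: congr1; apply: subvs_inj.
rewrite val_dual_pre !vsprojK //; apply/homvP => //; exact: rhom_comp.
Qed.

Lemma ev_inj xi xi' : (forall phi, rhom phi -> ev xi phi = ev xi' phi) -> xi = xi'.
Proof.
move=> E; apply: (@rsub_incl_inj _ _ _ _ (lker_stable nu_map_hom)); apply/lfunP => u.
by have /E := homvP _ (subvsP u); rewrite /ev vsvalK.
Qed.

Lemma ev_onto (F : 'Hom('Hom(P, reg), K^o)) :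
  (forall phi, rhom phi -> F (phi \o d)%VF = 0) ->
  exists xi, forall phi, rhom phi -> ev xi phi = F phi.
Proof.
move=> Fd.
have L : linear (fun u : dual P => F (vsval u)) by move=> k u v; rewrite linearP.
have [|xi xiE] := @rsub_lift _ _ _ _ (lker_stable nu_map_hom) (lfun_of L : nu P).
  rewrite memv_ker; apply/eqP/lfunP => u.
  by rewrite nu_mapE lfun_ofE zero_lfunE val_dual_pre Fd //; apply/homvP/subvsP.
exists xi => phi ph; rewrite /ev xiE lfun_ofE vsprojK //; exact/homvP.
Qed.

Lemma ev_rep (L : 'Hom(tau, K^o)) :
  exists2 phi, rhom phi & forall xi, L xi = ev xi phi.
Proof.
have [v vE] := bidual_eval (L \o subv_proj (lker nu_map))%VF.
exists (vsval v) => [|xi]; first exact/homvP/subvsP.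
rewrite /ev vsvalK -vE comp_lfunE; congr (L _).
symmetry; apply: etrans (subv_projE _ _) _.
by rewrite [rsub_incl _ _]subv_inclE vsvalK.
Qed.

(** A functional that vanishes on the image of Hom(P', A) is exactly an element of [tau], and such
    functionals separate phi from that image. *)
Lemma ev_annih phi : rhom phi -> (forall xi, ev xi phi = 0) ->
  exists2 phi', rhom phi' & phi = (phi' \o d)%VF.
Proof.
move=> ph phi0; have /memv_imgP[v _ vE] : vsproj (homv P reg) phi \in limg dual_pre.
  apply: functional_sep => xi xi0.
  have [|zeta zE] := @rsub_lift _ _ _ _ (lker_stable nu_map_hom) (xi : nu P).
    rewrite memv_ker; apply/eqP/lfunP => u.
    by rewrite nu_mapE zero_lfunE xi0 ?memv_img ?memvf.
  by rewrite -(phi0 zeta) /ev zE.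
exists (vsval v); first exact/homvP/subvsP.
by rewrite -val_dual_pre -vE vsprojK //; apply/homvP.
Qed.

End Tau.
End Transpose.

(** * Homomorphisms into the transpose and its endomorphisms *)

Section TauHoms.
Variables (K : fieldType) (A : falgType K).
Implicit Types X Y Z P : rmodule A.
Notation reg := (reg A).

(** A dual basis of Z reduces the factorization of g to that of the functionals theta_j g, whose
    factors are reassembled as a sum of rank-one maps. *)
Lemma dual_basis_factor P P' Z (d : 'Hom(P, P')) (g : 'Hom(P, Z)) :
  projective Z -> rhom g ->
  (forall theta : 'Hom(Z, reg), rhom theta -> exists2 chi : 'Hom(P', reg), rhom chi &
     forall x, theta (g x) = chi (d x)) ->
  exists2 h : 'Hom(P', Z), rhom h & forall x, g x = h (d x).
Proof.
move=> Zp gh gd; have [m [q [theta [th qE]]]] := dual_basis_exists Zp.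
have [chi ch chiE] := fin_all_exists2 (fun j => gd (theta j) (th j)).
exists (\sum_j outer (q j) (chi j)) => [|x].
  by apply: rhom_sum => j _; apply: rhom_outer.
by rewrite sum_lfunE (qE (g x)); apply: eq_bigr => j _; rewrite outerE chiE.
Qed.

Section Trace.
Variables (P P' : rmodule A) (d : 'Hom(P, P')) (dh : rhom d).
Hypotheses (Pp : projective P) (P'p : projective P').
Notation tau := (tau dh).

(* Together with [untrace], the isomorphism between Hom(Z, nu P) and
   the dual of Hom(P, Z), cut down to the submodule tau of nu P. *)
Lemma trace Z (f : 'Hom(Z, tau)) : rhom f ->
  exists F : 'Hom('Hom(P, Z), K^o),
  [/\ forall z phi, rhom phi -> F (outer z phi) = ev (f z) phi,
      forall mu : 'Hom(P', Z), rhom mu -> F (mu \o d)%VF = 0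
    & forall al : 'Hom(P, Z), (forall p, f (al p) = 0) -> F al = 0].
Proof.
move=> fh; have [m [p [phi db]]] := dual_basis_exists Pp; have [ph pE] := db.
have L : linear (fun al : 'Hom(P, Z) => \sum_i ev (f (al (p i))) (phi i) : K^o).
  move=> k a b; rewrite scaler_sumr -big_split; apply: eq_bigr => i _ /=.
  by rewrite !lfE linearP ev_linear_l.
have ev0 ps : ev (0 : tau) ps = 0 by rewrite /ev linear0 zero_lfunE.
(* This computes the functional on rank-one maps: expand [ps] as the sum of the ps(p_i) phi_i and
   move the coefficients across the pairing. *)
have key (z : Z) (ps : 'Hom(P, reg)) : rhom ps ->
    \sum_i ev (f (ract Z (ps (p i)) z)) (phi i) = ev (f z) ps.
  move=> psh; transitivity (ev (f z) (\sum_i lscale (ps (p i)) (phi i))).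
    by rewrite ev_sum; apply: eq_bigr => i _; rewrite fh ev_act.
  congr (ev _ _); apply/lfunP => x; rewrite sum_lfunE (dual_basis_hom db psh).
  by apply: eq_bigr => i _; rewrite lscaleE reg_ractE.
exists (lfun_of L); split=> [z ps psh|mu muh|al fal].
- by rewrite lfun_ofE -key //; apply: eq_bigr => i _; rewrite outerE.
- have [m' [q [th db']]] := dual_basis_exists P'p; have [thh qE] := db'.
  rewrite lfun_ofE.
  transitivity (\sum_i \sum_j ev (f (ract Z (th j (d (p i))) (mu (q j)))) (phi i)).
    apply: eq_bigr => i _; rewrite comp_lfunE (dual_basis_hom db' muh).
    by rewrite linear_sum ev_suml.
  rewrite exchange_big big1 // => j _ /=.
  have thdh : rhom (th j \o d)%VF by apply: rhom_comp.
  transitivity (ev (f (mu (q j))) (th j \o d)%VF); last exact: ev_pre.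
  by rewrite -key //; apply: eq_bigr => i _; rewrite comp_lfunE.
- by rewrite lfun_ofE big1 // => i _; rewrite fal ev0.
Qed.

(** For each z the functional phi |-> G(z phi) is a point of nu P, and the vanishing of G on maps
    through d puts it into the kernel [tau]. *)
Lemma untrace Z (G : 'Hom('Hom(P, Z), K^o)) :
  (forall be : 'Hom(P', Z), rhom be -> G (be \o d)%VF = 0) ->
  exists2 g : 'Hom(Z, tau), rhom g &
    forall z phi, rhom phi -> ev (g z) phi = G (outer z phi).
Proof.
move=> Gd.
have [|x y z xy xz|k x x' y y' xy xy'|g gE] := @lfun_choice _ Z tau
    (fun z xi => forall phi, rhom phi -> ev xi phi = G (outer z phi)).
- move=> z.
  have L : linear (fun phi : 'Hom(P, reg) => G (outer z phi)).
    move=> k a b; rewrite -linearP; congr (G _); apply/lfunP => p.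
    by rewrite !lfE !outerE !lfE ractDl ractZl.
  have [|xi xiE] := @ev_onto _ _ _ _ d dh (lfun_of L); last first.
    by exists xi => phi ph; rewrite xiE // lfun_ofE.
  move=> phi ph; rewrite lfun_ofE -(Gd (outer z phi)); last exact: rhom_outer.
  by congr (G _); apply/lfunP => p; rewrite !(outerE, comp_lfunE).
- by apply: ev_inj => phi ph; rewrite xy ?xz.
- move=> phi ph; rewrite ev_linear_l xy // xy' // -linearP; congr (G _).
  by apply/lfunP => p; rewrite !lfE !outerE linearP.
exists g => // b z; apply: ev_inj => phi ph; rewrite ev_act // !gE //; last exact: rhom_lscale.
by congr (G _); apply/lfunP => p; rewrite !outerE lscaleE ractM.
Qed.

(** By trace duality f is a functional on Hom(P, R1), and it factors through v once it vanishes on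
    every al such that v al factors through d. The hypothesis writes such an al as u ga + mu d; the
    first term dies because f u = 0, the second because f lands in [tau]. *)
Lemma tau_exact (R2 R1 R0 : rmodule A) (u : 'Hom(R2, R1)) (v : 'Hom(R1, R0)) :
  rhom u -> rhom v ->
  (forall (al : 'Hom(P, R1)) (be : 'Hom(P', R0)), rhom al -> rhom be ->
     (forall p, v (al p) = be (d p)) ->
     exists ga : 'Hom(P, R2), exists2 mu : 'Hom(P', R1), rhom mu &
       forall p, al p = u (ga p) + mu (d p)) ->
  forall f : 'Hom(R1, tau), rhom f -> (forall x, f (u x) = 0) ->
  exists2 g : 'Hom(R0, tau), rhom g & forall x, g (v x) = f x.
Proof.
move=> uh vh ex f fh fu; have [F [Fouter Fd F0]] := trace fh.
have TL : linear (fun al : 'Hom(P, R1) => v \o al)%VF.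
  by move=> k a b; rewrite comp_lfunDr comp_lfunZr.
have DL : linear (fun be : 'Hom(P', R0) => be \o d)%VF.
  by move=> k a b; rewrite comp_lfunDl comp_lfunZl.
have [al /homvP alh|G G0 GF] := @functional_ext _ _ _ (lfun_of TL) (homv P R1)
    (lfun_of DL @: homv P' R0)%VS F.
  rewrite lfun_ofE => /memv_imgP[be /homvP beh]; rewrite lfun_ofE => /lfunP E.
  have [p|ga [mu muh alE]] := ex al be alh beh; first by have := E p; rewrite !comp_lfunE.
  have -> : al = (u \o ga)%VF + (mu \o d)%VF.
    by apply/lfunP => p; rewrite !lfE.
  by rewrite linearD /= Fd // addr0 F0 // => p; rewrite comp_lfunE.
have [be beh|g gh gE] := @untrace _ G.
  by rewrite G0 // -(lfun_ofE DL) memv_img //; apply/homvP.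
exists g => // x; apply: ev_inj => phi ph; rewrite gE // -Fouter // -GF ?lfun_ofE.
  by congr (G _); apply/lfunP => p; rewrite !(outerE, comp_lfunE) vh.
by apply/homvP/rhom_outer.
Qed.

(** The transpose of [ep] acts on Coker Hom(d, A) and lifts to a chain endomorphism (f, f') of P ->
    P'. Representatives of the images of a dual basis define f; then f' exists because each th d f
    pairs to zero with [tau]. *)
Lemma tau_endo (ep : 'Hom(tau, tau)) : rhom ep ->
  exists f : 'Hom(P, P), exists f' : 'Hom(P', P'),
  [/\ rhom f, rhom f', forall x, f' (d x) = d (f x)
    & forall xi phi, rhom phi -> ev (ep xi) phi = ev xi (phi \o f)%VF].
Proof.
move=> eph; have [m [p [phi db]]] := dual_basis_exists Pp; have [ph pE] := db.
have L ps : linear (fun xi : tau => ev (ep xi) ps : K^o).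
  by move=> k a b; rewrite linearP ev_linear_l.
have [psi psih psiE] := fin_all_exists2 (fun i => ev_rep (lfun_of (L (phi i)))).
pose f := \sum_i outer (p i) (psi i).
have fh : rhom f by apply: rhom_sum => i _; apply: rhom_outer.
have fE xi ps : rhom ps -> ev (ep xi) ps = ev xi (ps \o f)%VF.
  move=> psh; transitivity (ev (ep xi) (\sum_i lscale (ps (p i)) (phi i))).
    congr (ev _ _); apply/lfunP => x; rewrite sum_lfunE (dual_basis_hom db psh).
    by apply: eq_bigr => i _; rewrite lscaleE reg_ractE.
  transitivity (ev xi (\sum_i lscale (ps (p i)) (psi i))); last first.
    congr (ev _ _); apply/lfunP => x; rewrite comp_lfunE !sum_lfunE linear_sum.
    by apply: eq_bigr => i _; rewrite outerE lscaleE /= psh reg_ractE.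
  rewrite !ev_sum; apply: eq_bigr => i _.
  by rewrite -!ev_act // -eph -psiE lfun_ofE.
have [||f' f'h f'E] := @dual_basis_factor P P' P' d (d \o f)%VF P'p.
- exact: rhom_comp.
- move=> th thh; have [||ch chh chE] := @ev_annih _ _ _ _ d dh (th \o d \o f)%VF.
  + by do 2?apply: rhom_comp.
  + by move=> xi; rewrite -fE ?ev_pre //; apply: rhom_comp.
  + by exists ch => // x; have /lfunP/(_ x) := chE; rewrite !comp_lfunE.
by exists f, f'; split=> // x; rewrite -f'E comp_lfunE.
Qed.

Lemma tau_endo0 (g : 'Hom(P, P)) : rhom g ->
  (forall (xi : tau) phi, rhom phi -> ev xi (phi \o g)%VF = 0) ->
  exists2 h : 'Hom(P', P), rhom h & forall x, g x = h (d x).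
Proof.
move=> gh g0; apply: dual_basis_factor => // th thh.
have [||ch chh chE] := @ev_annih _ _ _ _ d dh (th \o g)%VF.
- exact: rhom_comp.
- by move=> xi; rewrite g0.
- by exists ch => // x; have /lfunP/(_ x) := chE; rewrite !comp_lfunE.
Qed.

End Trace.
End TauHoms.

(** * Augmented projective resolutions *)

Section AugmentedResolutions.
Variables (K : fieldType) (A : falgType K).
Implicit Types X Y Z W P Q : rmodule A.
Notation reg := (reg A).

Record augmented (C : nat -> rmodule A) (d : forall k, 'Hom(C k.+1, C k)) : Prop :=
  Augmented {
    aug_proj : forall k, projective (C k.+1);
    aug_hom : forall k, rhom (d k);
    aug_surj : limg (d 0) = fullv;
    aug_exact : forall k, limg (d k.+1) = lker (d k) }.

Arguments aug_proj {C d} _ k.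
Arguments aug_hom {C d} _ k.

(* Exactness of Hom(C, Z) at [C j.+1]; as [C 0] is the resolved module, this is
   Ext^j(C 0, Z) = 0 for 0 < j, and always holds for j = 0. *)
Definition hom_exact (C : nat -> rmodule A) (d : forall k, 'Hom(C k.+1, C k)) Z j :=
  forall f : 'Hom(C j.+1, Z), rhom f -> (forall x, f (d j.+1 x) = 0) ->
  exists2 g : 'Hom(C j, Z), rhom g & forall x, g (d j x) = f x.

(* For consecutive components of a chain endomorphism this condition goes up and,
   when the relevant Ext vanish, down the complex; it thus stands in for the
   existence of a null homotopy without constructing one. *)
Definition stably_zero (C : nat -> rmodule A) (d : forall k, 'Hom(C k.+1, C k)) j
    (g : 'Hom(C j, C j)) :=
  exists2 h : 'Hom(C j, C j.+1), rhom h & forall x, g (d j x) = d j (h (d j x)).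

Section OneComplex.
Variables (C : nat -> rmodule A) (d : forall k, 'Hom(C k.+1, C k)).
Hypothesis Cd : augmented d.
Let dh := aug_hom Cd.

Lemma aug_dd k x : d k (d k.+1 x) = 0.
Proof.
by apply/eqP; rewrite -memv_ker -(aug_exact Cd) memv_img ?memvf.
Qed.

Lemma aug_lift Q k (f : 'Hom(Q, C k.+1)) : projective Q -> rhom f ->
  (forall x, d k (f x) = 0) ->
  exists2 g : 'Hom(Q, C k.+2), rhom g & forall x, d k.+1 (g x) = f x.
Proof.
move=> Qp fh f0; apply: proj_lift => // x.
by rewrite (aug_exact Cd) memv_ker f0.
Qed.

Lemma aug_lift0 Q (f : 'Hom(Q, C 0)) : projective Q -> rhom f ->
  exists2 g : 'Hom(Q, C 1), rhom g & forall x, d 0 (g x) = f x.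
Proof. by move=> Qp fh; apply: proj_lift => // x; rewrite (aug_surj Cd) memvf. Qed.

Lemma aug_surjP y : exists x, d 0 x = y.
Proof.
have /memv_imgP[x _ ->] : y \in limg (d 0) by rewrite (aug_surj Cd) memvf.
by exists x.
Qed.

Lemma aug_exactP k y : d k y = 0 -> exists x, d k.+1 x = y.
Proof.
move=> dy; have /memv_imgP[x _ ->] : y \in limg (d k.+1).
  by rewrite (aug_exact Cd) memv_ker dy.
by exists x.
Qed.

Lemma hom_exact0 Z : hom_exact d Z 0.
Proof.
move=> f fh fd; apply: epi_factor => //; first exact: aug_surj Cd.
by move=> x /aug_exactP[y <-].
Qed.

Lemma hom_exact_retract Z W j (i : 'Hom(Z, W)) (p : 'Hom(W, Z)) :
  rhom i -> rhom p -> (forall z, p (i z) = z) -> hom_exact d W j -> hom_exact d Z j.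
Proof.
move=> ih ph pi WE f fh fd.
have [|x|g gh gE] := WE (i \o f)%VF; first exact: rhom_comp.
  by rewrite comp_lfunE fd linear0.
by exists (p \o g)%VF => [|x]; [apply: rhom_comp | rewrite comp_lfunE gE comp_lfunE pi].
Qed.

Lemma rpow_hom W Z m (G : 'I_m -> 'Hom(W, Z)) :
  (forall t, rhom (G t)) ->
  exists2 g : 'Hom(W, rpow Z m), rhom g & forall x, g x = [ffun t => G t x].
Proof.
move=> Gh; have L : linear (fun x => [ffun t => G t x] : rpow Z m).
  by move=> k x y; apply/ffunP => t; rewrite !ffunE linearP.
exists (lfun_of L) => [b x|x]; last by rewrite lfun_ofE.
by rewrite !lfun_ofE [RHS]lfunE; apply/ffunP => t; rewrite !ffunE Gh.
Qed.

Lemma rpow_coord Z m (t : 'I_m) :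
  exists2 p : 'Hom(rpow Z m, Z), rhom p & forall c, p c = (c : {ffun _ -> _}) t.
Proof.
have L : linear (fun c : rpow Z m => (c : {ffun _ -> Z}) t) by move=> k c c'; rewrite !ffunE.
exists (lfun_of L) => [b c|c]; last by rewrite lfun_ofE.
by rewrite !lfun_ofE [ract (rpow _ _) _ _]lfunE ffunE.
Qed.

Lemma hom_exact_rpow Z m j : hom_exact d Z j -> hom_exact d (rpow Z m) j.
Proof.
move=> ZE f fh fd.
have [p ph pE] := fin_all_exists2 (@rpow_coord Z m).
have ex t : exists2 g : 'Hom(C j, Z), rhom g & forall x, g (d j x) = (f x : {ffun _ -> _}) t.
  have [|x|g gh gE] := ZE (p t \o f)%VF; first exact: rhom_comp.
    by rewrite comp_lfunE fd linear0.
  by exists g => // x; rewrite gE comp_lfunE pE.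
have [G Gh GE] := fin_all_exists2 ex.
have [g gh gE] := rpow_hom Gh.
by exists g => // x; rewrite gE; apply/ffunP => t; rewrite ffunE GE.
Qed.

Lemma proj_retract P : projective P ->
  exists m (i : 'Hom(P, rpow reg m)) (p : 'Hom(rpow reg m, P)),
    [/\ rhom i, rhom p & forall x, p (i x) = x].
Proof.
move=> Pp; have [m [p [phi [ph pE]]]] := dual_basis_exists Pp.
have [i ih iE] := rpow_hom ph.
have sL : linear (fun c : rpow reg m => \sum_t ract P ((c : {ffun _ -> _}) t) (p t)).
  move=> k c c'; rewrite scaler_sumr -big_split; apply: eq_bigr => t _ /=.
  by rewrite !ffunE ractDl ractZl.
exists m, i, (lfun_of sL); split=> // [b c|x].
  rewrite !lfun_ofE linear_sum; apply: eq_bigr => t _.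
  by rewrite [ract (rpow _ _) _ _]lfunE ffunE reg_ractE ractM.
by rewrite lfun_ofE iE {2}(pE x); apply: eq_bigr => t _; rewrite ffunE.
Qed.

Lemma hom_exact_proj P j : projective P -> hom_exact d reg j -> hom_exact d P j.
Proof.
move=> /proj_retract[m [i [p [ih ph pi]]]] rE.
exact: (hom_exact_retract ih ph pi (hom_exact_rpow rE)).
Qed.

Lemma stably_zero_split j (g : 'Hom(C j, C j)) (g' : 'Hom(C j.+1, C j.+1)) :
  rhom g' -> (forall x, g (d j x) = d j (g' x)) -> stably_zero d g ->
  exists h : 'Hom(C j, C j.+1), exists h' : 'Hom(C j.+1, C j.+2),
    [/\ rhom h, rhom h' & forall x, g' x = h (d j x) + d j.+1 (h' x)].
Proof.
move=> g'h gg' [h hh hE].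
have [||x|h' h'h h'E] := @aug_lift _ j (g' - (h \o d j)%VF).
- exact: (aug_proj Cd).
- by apply: rhomB => //; apply: rhom_comp.
- by rewrite !lfE linearB /= -gg' hE subrr.
by exists h, h'; split=> // x; rewrite h'E !lfE addrC subrK.
Qed.

Lemma stably_zero_up j (g : 'Hom(C j, C j)) (g' : 'Hom(C j.+1, C j.+1)) :
  rhom g' -> (forall x, g (d j x) = d j (g' x)) ->
  stably_zero d g -> stably_zero d g'.
Proof.
move=> g'h gg' gz; have [h [h' [hh h'h E]]] := stably_zero_split g'h gg' gz.
by exists h' => // x; rewrite E aug_dd linear0 add0r.
Qed.

(** The map g' - d h kills the image of the next differential, so by exactness of Hom it factors
    through [d j]; the factor is the homotopy one degree lower. *)
Lemma stably_zero_down j (g : 'Hom(C j, C j)) (g' : 'Hom(C j.+1, C j.+1)) :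
  rhom g' -> (forall x, g (d j x) = d j (g' x)) -> hom_exact d (C j.+1) j ->
  stably_zero d g' -> stably_zero d g.
Proof.
move=> g'h gg' ex [h hh hE].
have [|x|s sh sE] := ex (g' - (d j.+1 \o h)%VF).
- by apply: rhomB => //; apply: rhom_comp.
- by rewrite !lfE hE subrr.
exists s => // x; rewrite gg' sE !lfE linearB /= aug_dd subr0 //.
Qed.

End OneComplex.

(** * Comparison of two resolutions *)

Section Comparison.
Variables (C C' : nat -> rmodule A).
Variables (d : forall k, 'Hom(C k.+1, C k)) (d' : forall k, 'Hom(C' k.+1, C' k)).
Hypotheses (Cd : augmented d) (Cd' : augmented d').
Variables (a0 : 'Hom(C 0, C' 0)) (b0 : 'Hom(C' 0, C 0)).
Hypotheses (a0h : rhom a0) (b0h : rhom b0) (ba0 : forall x, b0 (a0 x) = x).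

(** Only two consecutive components of the chain maps are carried, since [stably_zero] climbs one
    degree at a time; no infinite chain map or homotopy is chosen. *)
Lemma comparison j :
  exists (a : 'Hom(C j, C' j)) (b : 'Hom(C' j, C j))
         (a' : 'Hom(C j.+1, C' j.+1)) (b' : 'Hom(C' j.+1, C j.+1)),
  [/\ [/\ rhom a, rhom b, rhom a' & rhom b'], forall x, a (d j x) = d' j (a' x),
      forall x, b (d' j x) = d j (b' x) & stably_zero d (\1 - (b \o a))%VF].
Proof.
elim: j => [|j [a [b [a' [b' [[ah bh a'h b'h] aE bE st]]]]]].
  have [||a' a'h a'E] := @aug_lift0 _ _ Cd' _ (a0 \o d 0)%VF.
  - exact: (aug_proj Cd).
  - by apply: rhom_comp; [|apply: aug_hom].
  have [||b' b'h b'E] := @aug_lift0 _ _ Cd _ (b0 \o d' 0)%VF.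
  - exact: (aug_proj Cd').
  - by apply: rhom_comp; [|apply: aug_hom].
  exists a0, b0, a', b'; split=> // [x|x|].
  - by rewrite a'E comp_lfunE.
  - by rewrite b'E comp_lfunE.
  by exists 0 => [|x]; rewrite ?lfE ?ba0 ?subrr ?linear0 //; apply: rhom0.
have [|||a'' a''h a''E] := @aug_lift _ _ Cd' _ j (a' \o d j.+1)%VF.
- exact: (aug_proj Cd).
- by apply: rhom_comp; [|apply: aug_hom].
- by move=> x; rewrite comp_lfunE -aE aug_dd // linear0.
have [|||b'' b''h b''E] := @aug_lift _ _ Cd _ j (b' \o d' j.+1)%VF.
- exact: (aug_proj Cd').
- by apply: rhom_comp; [|apply: aug_hom].
- by move=> x; rewrite comp_lfunE -bE aug_dd // linear0.
exists a', b', a'', b''; split=> // [x|x|].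
- by rewrite a''E comp_lfunE.
- by rewrite b''E comp_lfunE.
apply: (stably_zero_up Cd) st => [|x].
  by apply: rhomB; [apply: rhom1|apply: rhom_comp].
by rewrite !lfE aE bE linearB.
Qed.

(** Write f as f b' a' + f (1 - b' a'). The first term factors through [d j] by exactness for C',
    the second because 1 - b' a' is h d + d h' and f kills the image of d. *)
Lemma hom_exact_comparison Z j : hom_exact d' Z j -> hom_exact d Z j.
Proof.
move=> ex f fh fd.
have [a [b [a' [b' [[ah bh a'h b'h] aE bE st]]]]] := comparison j.
have fz y : d j y = 0 -> f y = 0 by move=> /(aug_exactP Cd)[x <-].
have [|x|g gh gE] := ex (f \o b')%VF; first exact: rhom_comp.
  by rewrite comp_lfunE fz // -bE aug_dd // linear0.
have [||h [h' [hh h'h E]]] := @stably_zero_split _ _ Cd j _ (\1 - (b' \o a'))%VF _ _ st.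
- by apply: rhomB; [apply: rhom1|apply: rhom_comp].
- by move=> x; rewrite !lfE aE bE linearB.
exists ((g \o a) + (f \o h))%VF => [|x].
  by apply: rhomD; apply: rhom_comp.
rewrite !lfE aE gE comp_lfunE.
have := E x; rewrite !lfE => Ex.
rewrite -[in RHS](subrK (b' (a' x)) x) Ex !linearD /= fd addr0 addrC //.
Qed.

End Comparison.

(** * The staircase argument in the double complex Hom(C, D) *)

Section ExtTau.
Variables (C D : nat -> rmodule A).
Variables (d : forall k, 'Hom(C k.+1, C k)) (D_ : forall k, 'Hom(D k.+1, D k)).
Hypotheses (Cd : augmented d) (Dd : augmented D_).
Variable n : nat.
Hypothesis CD : forall i j, (j < n)%N -> hom_exact d (D i) j.

(** The composite be d has to be a cocycle for the differential of D; out of D 0 there is no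
    differential, hence no condition. *)
Definition mixed_cocycle j i : 'Hom(C j.+1, D i) -> Prop :=
  match i with
  | 0 => fun => True
  | i'.+1 => fun be => forall x, D_ i' (be (d j.+1 x)) = 0
  end.

(** Exactness of Hom(C, D i) turns D be into be' d, with both indices lowered by one; the bound i <=
    j lets the staircase reach D 0, where surjectivity of the augmentation ends it. On the way back,
    be - ga d lifts along D, and the correction ga d disappears after composing with d. *)
Lemma mixed_cocycle_split i j (be : 'Hom(C j.+1, D i)) : (i <= j < n)%N -> rhom be ->
  mixed_cocycle be ->
  exists2 ga : 'Hom(C j.+1, D i.+1), rhom ga &
    forall x, be (d j.+1 x) = D_ i (ga (d j.+1 x)).
Proof.
elim: i j be => [|i IH] j be /andP[ij jn] beh beP.
  have [ga gah gaE] := aug_lift0 Dd (aug_proj Cd j) beh.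
  by exists ga => // x; rewrite gaE.
have [||be' be'h be'E] := CD (i := i) jn (f := (D_ i \o be)%VF).
- by apply: rhom_comp => //; apply: aug_hom.
- by move=> x; rewrite comp_lfunE beP.
case: j ij jn be beh beP be' be'h be'E => // j ij jn be beh beP be' be'h be'E.
have [||ga gah gaE] := IH j be' _ be'h.
- by rewrite -ltnS ij ltnW.
- case: i {IH ij} be be' beP be'E {beh be'h} => //= i be be' beP be'E x.
  by rewrite be'E comp_lfunE aug_dd.
have [||gb gbh gbE] := aug_lift Dd (k := i) (aug_proj Cd j.+1) (f := be - (ga \o d j.+1)%VF).
- by apply: rhomB => //; apply: rhom_comp => //; apply: aug_hom.
- by move=> x; rewrite !lfE linearB /= -gaE be'E comp_lfunE subrr.
exists gb => // x; rewrite gbE !lfE aug_dd // linear0 subr0 //.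
Qed.

End ExtTau.

End AugmentedResolutions.
Arguments aug_proj {K A C d} _ k.
Arguments aug_hom {K A C d} _ k.

(** * Summands, indecomposability and resolutions *)

Section Decompositions.
Variables (K : fieldType) (A : falgType K).
Implicit Types X Y Z W P Q : rmodule A.
Notation reg := (reg A).

Definition retract X Y : Prop :=
  exists (i : 'Hom(X, Y)) (p : 'Hom(Y, X)),
    [/\ rhom i, rhom p & forall x, p (i x) = x].

Lemma retract_proj X P : retract X P -> projective P -> projective X.
Proof.
move=> [i [p [ih ph pi]]] Pp Y Z g h gh gs hh.
have [h' h'h h'E] := Pp Y Z g (h \o p)%VF gh gs (rhom_comp hh ph).
exists (h' \o i)%VF; first exact: rhom_comp.
apply/lfunP => x; have /lfunP/(_ (i x)) := h'E.
by rewrite !comp_lfunE pi.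
Qed.

Lemma riso_inv X Y : riso X Y -> exists (f : 'Hom(X, Y)) (g : 'Hom(Y, X)),
  [/\ rhom f, rhom g, forall x, g (f x) = x & forall y, f (g y) = y].
Proof.
move=> [f [fh /eqP f0 fs]]; exists f, (f^-1)%VF.
have fK := lker0_lfunK f0; have fVK y : f (f^-1%VF y) = y.
  by rewrite limg_lfunVK // fs memvf.
split=> // b y; apply: (can_inj fK).
by rewrite fVK fh fVK.
Qed.

Lemma riso_of_bij X Y (f : 'Hom(X, Y)) : rhom f -> (forall x, f x = 0 -> x = 0) ->
  (forall y, exists x, f x = y) -> riso X Y.
Proof.
move=> fh fi fs; exists f; split=> //.
  apply/eqP; rewrite -subv0; apply/subvP => x.
  by rewrite memv_ker memv0 => /eqP/fi ->.
apply/eqP; rewrite eqEsubv subvf /=; apply/subvP => y _.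
by have [x <-] := fs y; rewrite memv_img ?memvf.
Qed.

Fact pair_fst_linear (U V : vectType K) : linear (fun u : U * V => u.1). Proof. by []. Qed.
Fact pair_snd_linear (U V : vectType K) : linear (fun u : U * V => u.2). Proof. by []. Qed.
Fact pair_inl_linear (U V : vectType K) : linear (fun u : U => (u, 0 : V)).
Proof.
move=> k u v; apply: (congr2 pair) => //=.
by rewrite scaler0 addr0.
Qed.
Definition rfst X Y : 'Hom(rsum X Y, X) := lfun_of (@pair_fst_linear X Y).
Definition rsnd X Y : 'Hom(rsum X Y, Y) := lfun_of (@pair_snd_linear X Y).
Definition rinl X Y : 'Hom(X, rsum X Y) := lfun_of (@pair_inl_linear X Y).

Lemma rsum_ractE X Y b (u : rsum X Y) :
  ract (rsum X Y) b u = (ract X b u.1, ract Y b u.2).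
Proof. by rewrite [LHS]lfunE. Qed.

Lemma rfst_hom X Y : rhom (rfst X Y).
Proof. by move=> b u; rewrite !lfun_ofE rsum_ractE. Qed.
Lemma rsnd_hom X Y : rhom (rsnd X Y).
Proof. by move=> b u; rewrite !lfun_ofE rsum_ractE. Qed.
Lemma rinl_hom X Y : rhom (rinl X Y).
Proof. by move=> b u; rewrite !lfun_ofE rsum_ractE /= linear0. Qed.

Lemma summand_retract X Y : summand X Y -> retract X Y.
Proof.
move=> [Z /riso_inv[f [g [fh gh gf fg]]]].
exists (f \o rinl X Z)%VF, (rfst X Z \o g)%VF; split.
- by apply: rhom_comp => //; apply: rinl_hom.
- by apply: rhom_comp => //; apply: rfst_hom.
by move=> x; rewrite !comp_lfunE gf !lfun_ofE.
Qed.

Section InternalSum.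
Variables (X : rmodule A) (U V : {vspace X}).
Hypothesis Ust : forall b x, x \in U -> ract X b x \in U.
Hypothesis Vst : forall b x, x \in V -> ract X b x \in V.

Lemma internal_sum : (U :&: V = 0)%VS -> (U + V = fullv)%VS ->
  riso (rsum (rsub Ust) (rsub Vst)) X.
Proof.
move=> UV0 UVf.
pose f : 'Hom(rsum (rsub Ust) (rsub Vst), X) :=
  ((rsub_incl Ust \o rfst _ _) + (rsub_incl Vst \o rsnd _ _))%VF.
have fE u : f u = rsub_incl Ust u.1 + rsub_incl Vst u.2.
  by rewrite add_lfunE !comp_lfunE !lfun_ofE.
apply: (@riso_of_bij _ _ f).
- by apply: rhomD; apply: rhom_comp; (apply: rsub_incl_hom || apply: rfst_hom || apply: rsnd_hom).
- case=> u v; rewrite fE /= => /eqP; rewrite addr_eq0 => /eqP E.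
  have u0 : rsub_incl Ust u = 0.
    apply/eqP; rewrite -memv0 -UV0 memv_cap rsub_incl_mem E memvN.
    exact: rsub_incl_mem.
  have v0 : rsub_incl Vst v = 0 by apply/eqP; rewrite -oppr_eq0 -E u0.
  apply: (congr2 pair).
    by apply: (@rsub_incl_inj _ _ _ _ Ust); rewrite u0 linear0.
  by apply: (@rsub_incl_inj _ _ _ _ Vst); rewrite v0 linear0.
- move=> x; have /memv_addP[u uU [v vV ->]] : x \in (U + V)%VS by rewrite UVf memvf.
  have [u' <-] := rsub_lift Ust uU; have [v' <-] := rsub_lift Vst vV.
  by exists (u', v'); rewrite fE.
Qed.

Lemma indecomposable_internal : indecomposable X ->
  (U :&: V = 0)%VS -> (U + V = fullv)%VS -> (U = 0 \/ V = 0)%VS.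
Proof.
move=> [_ Xi] UV0 /(internal_sum UV0)/Xi[Z0|Z0]; [left|right];
  apply/eqP; rewrite -subv0; apply/subvP => x xU.
  by have [u <-] := rsub_lift Ust xU; rewrite (Z0 u) linear0 mem0v.
by have [u <-] := rsub_lift Vst xU; rewrite (Z0 u) linear0 mem0v.
Qed.

End InternalSum.

Lemma indecomposable_idem X (u : 'Hom(X, X)) : indecomposable X -> rhom u ->
  (forall x, u (u x) = u x) -> (forall x, u x = 0) \/ (forall x, u x = x).
Proof.
move=> Xi uh uu.
have [||k0|i0] := indecomposable_internal (lker_stable uh) (limg_stable uh) Xi.
- apply/eqP; rewrite -subv0; apply/subvP => x.
  rewrite memv_cap memv_ker memv0 => /andP[/eqP x0 /memv_imgP[y _ yE]].
  by move: x0; rewrite yE uu => ->.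
- apply/eqP; rewrite eqEsubv subvf /=; apply/subvP => x _.
  rewrite -(subrK (u x) x) memv_add ?memv_img ?memvf //.
  by rewrite memv_ker linearB /= uu subrr.
- right=> x; apply/eqP; rewrite -subr_eq0 -memv0 -k0 memv_ker linearB /=.
  by rewrite uu subrr.
- by left=> x; apply/eqP; rewrite -memv0 -i0 memv_img ?memvf.
Qed.

Lemma idem_indecomposable X : ~ rzero X ->
  (forall u : 'Hom(X, X), rhom u -> (forall x, u (u x) = u x) ->
     (forall x, u x = 0) \/ (forall x, u x = x)) -> indecomposable X.
Proof.
move=> X0 Xi; split=> // Y Z /riso_inv[f [g [fh gh gf fg]]].
have [pr prh prE] : exists2 pr : 'Hom(rsum Y Z, rsum Y Z), rhom pr &
    forall x, pr x = (x.1, 0).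
  exists (rinl Y Z \o rfst Y Z)%VF => [|x]; last by rewrite comp_lfunE !lfun_ofE.
  by apply: rhom_comp; [apply: rinl_hom|apply: rfst_hom].
have [||E|E] := Xi (f \o pr \o g)%VF.
- by do 2?apply: rhom_comp.
- by move=> x; rewrite !comp_lfunE gf !prE.
- left=> y; have := E (f (y, 0)); rewrite !comp_lfunE gf prE /=.
  by move/(congr1 g); rewrite gf linear0 => /(congr1 fst).
- right=> z; have := E (f (0, z)); rewrite !comp_lfunE gf prE /=.
  by move/(can_inj gf)/(congr1 snd).
Qed.

(** * Fitting's lemma and local endomorphism rings *)

Section Fitting.
Variables (X : rmodule A) (Xi : indecomposable X).

Lemma injective_endo_inv (f : 'Hom(X, X)) : rhom f -> (forall x, f x = 0 -> x = 0) ->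
  exists2 g : 'Hom(X, X), rhom g & (forall x, g (f x) = x) /\ forall x, f (g x) = x.
Proof.
move=> fh f0; have k0 : lker f == 0%VS.
  by rewrite -subv0; apply/subvP => x; rewrite memv_ker memv0 => /eqP/f0 ->.
have fK := lker0_lfunK k0; have fVK := lker0_lfunVK k0.
exists (f^-1)%VF => // b x.
by apply: (can_inj fK); rewrite fVK fh fVK.
Qed.

(** This is f to the power 2^k. With squarings, two equal consecutive kernels already say ker g =
    ker g^2, which is all that Fitting's decomposition into kernel and image of g needs. *)
Fixpoint sqr_iter (f : 'Hom(X, X)) k : 'Hom(X, X) :=
  if k is k'.+1 then (sqr_iter f k' \o sqr_iter f k')%VF else f.

Lemma sqr_iter_hom f k : rhom f -> rhom (sqr_iter f k).
Proof. by move=> fh; elim: k => //= k IH; apply: rhom_comp. Qed.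

Lemma sqr_iter_ker f k : (lker (sqr_iter f k) <= lker (sqr_iter f k.+1))%VS.
Proof.
by apply/subvP => x; rewrite !memv_ker /= comp_lfunE => /eqP ->; rewrite linear0.
Qed.

Lemma sqr_iter_stationary f : exists k, lker (sqr_iter f k) = lker (sqr_iter f k.+1).
Proof.
apply: Classical_Prop.NNPP => nex.
have lt k : (k <= \dim (lker (sqr_iter f k)))%N.
  elim: k => // k IH; apply: leq_ltn_trans IH _; rewrite ltnNge; apply/negP => le.
  by case: nex; exists k; apply/eqP; rewrite eqEdim sqr_iter_ker.
have := lt (\dim {:X}).+1; rewrite leqNgt => /negP[].
by rewrite ltnS dimvS ?subvf.
Qed.

Lemma endo_nilp_or_inj (f : 'Hom(X, X)) : rhom f ->
  (exists k, forall x, sqr_iter f k x = 0) \/ (forall x, f x = 0 -> x = 0).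
Proof.
move=> fh; have [k kE] := sqr_iter_stationary f.
have gh := sqr_iter_hom k fh; set g := sqr_iter f k in kE gh.
have cap0 : (lker g :&: limg g = 0)%VS.
  apply/eqP; rewrite -subv0; apply/subvP => x.
  rewrite memv_cap memv0 => /andP[xk /memv_imgP[y _ yE]]; rewrite yE -memv_ker kE.
  by rewrite memv_ker /= comp_lfunE -yE -memv_ker.
have sumf : (lker g + limg g = fullv)%VS.
  apply/eqP; rewrite eqEdim subvf /= dimv_disjoint_sum //.
  by rewrite -(limg_ker_dim g fullv) capfv.
have [k0|i0] := indecomposable_internal (lker_stable gh) (limg_stable gh) Xi cap0 sumf.
  right=> x fx; apply/eqP; rewrite -memv0 -k0 memv_ker /g.
  by elim: k {kE g gh cap0 sumf k0} => /= [|k IH]; rewrite ?fx // comp_lfunE (eqP IH) linear0.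
by left; exists k => x; apply/eqP; rewrite -memv0 -i0 memv_img ?memvf.
Qed.

(** If f is nilpotent, every x killed by g is fixed by f, hence by all its powers, hence zero. *)
Lemma endo_local (f g : 'Hom(X, X)) : rhom f -> rhom g ->
  (forall x, f x + g x = x) -> (forall x, f x = 0 -> x = 0) \/ (forall x, g x = 0 -> x = 0).
Proof.
move=> fh gh fg; have [[k k0]|] := endo_nilp_or_inj fh; [right|by left].
move=> x gx; have fx : f x = x by rewrite -{2}(fg x) gx addr0.
rewrite -(k0 x); elim: k {k0} => //= k IH.
by rewrite comp_lfunE -!IH.
Qed.

Lemma endo_sum_inj (I : Type) (r : seq I) (F : I -> 'Hom(X, X)) :
  (forall i, rhom (F i)) -> (forall x, (\sum_(i <- r) F i) x = 0 -> x = 0) ->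
  exists i, forall x, F i x = 0 -> x = 0.
Proof.
move=> Fh; elim: r => [|i r IH] inj.
  by case: (Xi) => X0 _; case: X0 => x; apply: inj; rewrite big_nil zero_lfunE.
have sh : rhom (\sum_(j <- i :: r) F j) by apply: rhom_sum.
have rh : rhom (\sum_(j <- r) F j) by apply: rhom_sum.
have [h hh [hK _]] := injective_endo_inv sh inj.
have [||x|E|E] := @endo_local (h \o F i)%VF (h \o \sum_(j <- r) F j)%VF.
- exact: rhom_comp.
- exact: rhom_comp.
- by have := hK x; rewrite big_cons add_lfunE linearD !comp_lfunE.
- by exists i => x Fx; apply: E; rewrite comp_lfunE Fx linear0.
- by apply: IH => x rx; apply: E; rewrite comp_lfunE rx linear0.
Qed.

(** The identity of X is a sum of m endomorphisms, one through each copy of Y; since the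
    endomorphism ring is local, one of them is invertible. *)
Lemma retract_rpow Y m : retract X (rpow Y m) -> retract X Y.
Proof.
move=> [i [p [ih ph pi]]].
have [c ch cE] := fin_all_exists2 (@rpow_coord _ _ Y m).
have JL t : linear (fun y : Y => [ffun s => if s == t then y else 0] : rpow Y m).
  move=> k y y'; apply/ffunP => s; rewrite !ffunE.
  by case: eqP; rewrite ?scaler0 ?addr0.
have Jh t : rhom (lfun_of (JL t)).
  move=> b y; rewrite !lfun_ofE [ract (rpow _ _) _ _]lfunE; apply/ffunP => s.
  by rewrite !ffunE; case: eqP; rewrite ?linear0.
pose F t := (p \o lfun_of (JL t) \o (c t \o i))%VF.
have [t||t tinj] := @endo_sum_inj _ (index_enum 'I_m) F.
- by do ?apply: rhom_comp.
- move=> x; suff -> : (\sum_t F t) x = x by [].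
  rewrite sum_lfunE -{2}(pi x).
  under eq_bigr do rewrite !comp_lfunE.
  rewrite -linear_sum; congr (p _); apply/ffunP => s.
  rewrite sum_ffunE (bigD1 s) //= lfun_ofE ffunE eqxx cE big1 ?addr0 // => t ts.
  by rewrite lfun_ofE ffunE eq_sym (negPf ts).
have Fh : rhom (F t) by do ?apply: rhom_comp.
have [g gh [gF _]] := injective_endo_inv Fh tinj.
exists (c t \o i)%VF, (g \o p \o lfun_of (JL t))%VF; split.
- by do ?apply: rhom_comp.
- by do ?apply: rhom_comp.
by move=> x; have := gF x; rewrite !comp_lfunE.
Qed.

End Fitting.

Lemma in_add_retract X M : indecomposable X -> in_add M X -> retract X M.
Proof. by move=> Xi [k /summand_retract]; apply: retract_rpow. Qed.

Lemma summand_in_add X M : summand X M -> in_add M X.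
Proof.
move=> [Z /riso_inv[f [g [fh gh gf fg]]]]; exists 1%N, Z.
have [c ch cE] := fin_all_exists2 (@rpow_coord _ _ M 1).
have [h hh hE] := @rpow_hom _ _ (rsum X Z) M 1 (fun=> f) (fun=> fh).
apply: (riso_of_bij hh) => [x|y].
  by rewrite hE => /ffunP/(_ ord0); rewrite !ffunE => fx; rewrite -(gf x) fx linear0.
exists (g (c ord0 y)); rewrite hE; apply/ffunP => s.
by rewrite ffunE fg cE (ord1 s).
Qed.

End Decompositions.

(** * Resolutions as augmented complexes *)

Section Resolutions.
Variables (K : fieldType) (A : falgType K).
Implicit Types X Y Z W P Q : rmodule A.
Notation reg := (reg A).

Section Aug.
Variables (X : rmodule A) (P : resolution X).

Definition aug_mod k : rmodule A := if k is j.+1 then res_mod P j else X.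

Definition aug_d k : 'Hom(aug_mod k.+1, aug_mod k) :=
  match k return 'Hom(aug_mod k.+1, aug_mod k) with
  | 0 => res_aug P
  | j.+1 => res_d P j
  end.

Lemma aug_res : augmented aug_d.
Proof.
split=> [k|[|k]||[|k]] /=.
- exact: res_proj.
- exact: res_aug_hom.
- exact: res_d_hom.
- exact: res_aug_surj.
- exact: res_exact0.
- exact: res_exactS.
Qed.

Lemma hom_exact_atP Y k : hom_exact_at Y P k.+1 <-> hom_exact aug_d Y k.+1.
Proof.
split=> E f fh fd /=.
  have [|g gh ->] := E f fh.
    by apply/lfunP => x; rewrite comp_lfunE [LHS]fd zero_lfunE.
  by exists g => // x; rewrite comp_lfunE.
have [x|g gh gE] := E f fh.
  by have /lfunP/(_ x) := fd; rewrite comp_lfunE zero_lfunE.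
by exists g => //; apply/lfunP => x; rewrite comp_lfunE; apply/esym/gE.
Qed.

End Aug.

Lemma rpow0_zero Y : rzero (rpow Y 0).
Proof. by move=> x; apply/ffunP => -[]. Qed.

Lemma limg0_rzero Y Z (f : 'Hom(Y, Z)) : rzero Y -> limg f = 0%VS.
Proof.
move=> Y0; apply/eqP; rewrite -subv0; apply/subvP => _ /memv_imgP[x _ ->].
by rewrite (Y0 x) linear0 mem0v.
Qed.

Lemma lker0_rzero Y Z (f : 'Hom(Y, Z)) : rzero Y -> lker f = 0%VS.
Proof.
move=> Y0; apply/eqP; rewrite -subv0; apply/subvP => x _.
by rewrite (Y0 x) mem0v.
Qed.

Lemma rzero_projective Y : rzero Y -> projective Y.
Proof.
move=> Y0 X Z g h _ _ _; exists 0; first exact: rhom0.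
by apply/lfunP => x; rewrite (Y0 x) !linear0.
Qed.

Section TrivialResolution.
Variables (P : rmodule A) (Pp : projective P).
Let R k := if k is 0 then P else rpow P 0.

Definition trivial_resolution : resolution P.
Proof.
refine (@Resolution K A P R (fun k => 0) \1%VF _ _ _ _ _ _).
- case=> [|k] //; apply: rzero_projective; exact: rpow0_zero.
- by move=> k; apply: rhom0.
- exact: rhom1.
- exact: lim1g.
- by rewrite lim0g; apply/esym/eqP/lker0P => x y; rewrite !id_lfunE.
- by move=> k; rewrite lim0g lker0_rzero //; apply: rpow0_zero.
Defined.

Lemma Ext_zero_proj i Y : (0 < i)%N -> Ext_zero i P Y.
Proof.
case: i => // i _; exists trivial_resolution => f _ _; exists 0; first exact: rhom0.
apply/lfunP => x; have -> : x = 0 by apply: rpow0_zero.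
by rewrite !linear0.
Qed.

End TrivialResolution.

Lemma Ext_zero_hom_exact X Y (P : resolution X) k :
  Ext_zero k.+1 X Y -> hom_exact (aug_d P) Y k.+1.
Proof.
move=> [P' /hom_exact_atP E].
apply: (hom_exact_comparison (aug_res P) (aug_res P') (a0 := \1%VF) (b0 := \1%VF)) E.
- exact: rhom1.
- exact: rhom1.
- by move=> x; rewrite !id_lfunE.
Qed.

End Resolutions.

(** * Vanishing of Hom(X, A) *)

Section HigherAR.
Variables (K : fieldType) (A : falgType K).
Implicit Types X Y Z W P Q : rmodule A.
Notation reg := (reg A).

Section Bounded.
Variables (C : nat -> rmodule A) (d : forall k, 'Hom(C k.+1, C k)).
Hypothesis Cd : augmented d.
Variable n : nat.
Hypothesis Creg : forall j, (j < n)%N -> hom_exact d reg j.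

Section LiftToFirstSyzygy.
Variables (D : nat -> rmodule A) (D_ : forall k, 'Hom(D k.+1, D k)).
Hypothesis Dd : augmented D_.
Hypothesis Dn : forall k, (n < k)%N -> rzero (D k.+1).

(** Descending induction on i, with m as fuel. Once n <= i+1 the term [D i.+3] is zero, and any lift
    ga satisfies ga d = 0. Below that, ga d is a cocycle one step up; its lift has the form de d by
    exactness of Hom into projectives, and ga is corrected by D de. *)
Lemma lift_cocycle m i (be : 'Hom(C i.+1, D i.+1)) : (n <= i + m)%N -> rhom be ->
  (forall x, be (d i.+1 x) = 0) -> (forall x, D_ i (be x) = 0) ->
  exists2 ka : 'Hom(C i.+1, D i.+2), rhom ka &
    (forall x, D_ i.+1 (ka x) = be x) /\ (forall x, ka (d i.+1 x) = 0).
Proof.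
elim: m i be => [|m IH] i be nim beh bed dbe;
  have [ga gah gaE] := aug_lift Dd (aug_proj Cd i) beh dbe.
all: have [ni|ni] := leqP n i.+1.
1,3: exists ga => //; split=> // x.
1,2: have /(aug_exactP Dd)[y <-] : D_ i.+1 (ga (d i.+1 x)) = 0 by rewrite gaE bed.
1,2: by rewrite (Dn (k := i.+2) _ y) ?linear0.
  by move: ni; rewrite ltnNge (leq_trans nim) // addn0.
have gdh : rhom (ga \o d i.+1)%VF by apply: rhom_comp => //; apply: aug_hom.
have [|x|x|ka' ka'h [ka'E ka'd]] := IH i.+1 _ _ gdh.
- by rewrite addSnnS.
- by rewrite comp_lfunE aug_dd // linear0.
- by rewrite comp_lfunE gaE bed.
have [de deh deE] := hom_exact_proj (aug_proj Dd _) (Creg ni) ka'h ka'd.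
exists (ga - (D_ i.+2 \o de))%VF.
  by apply: rhomB => //; apply: rhom_comp => //; apply: aug_hom.
split=> x; rewrite !lfE ?linearB /= ?gaE.
  by rewrite (aug_dd Dd) subr0.
by rewrite deE ka'E comp_lfunE subrr.
Qed.

(** So maps from X to a first syzygy vanish stably: h d is a cocycle, and its lift kills the image
    of [d 1], hence descends to X. *)
Lemma lift_to_syzygy (h : 'Hom(C 0, D 1)) : rhom h -> (forall x, D_ 0 (h x) = 0) ->
  exists2 ka : 'Hom(C 0, D 2), rhom ka & forall x, D_ 1 (ka x) = h x.
Proof.
move=> hh h0.
have [||x|x|ka0 ka0h [ka0E ka0d]] := @lift_cocycle n 0 (h \o d 0)%VF.
- by rewrite add0n.
- by apply: rhom_comp => //; apply: aug_hom.
- by rewrite comp_lfunE aug_dd // linear0.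
- by rewrite comp_lfunE h0.
have [ka kah kaE] := hom_exact0 Cd ka0h ka0d.
exists ka => // x; have [y <-] := aug_surjP Cd x.
by rewrite kaE ka0E comp_lfunE.
Qed.

End LiftToFirstSyzygy.

(** The counterpart of [trace] with the dual basis on Z instead of P, which makes it applicable to
    the source X. *)
Lemma cotrace P P' (dP : 'Hom(P, P')) (dPh : rhom dP) Z (g : 'Hom(Z, tau dPh)) :
  projective Z -> rhom g ->
  exists F : 'Hom('Hom(P, Z), K^o),
    forall w chi, rhom chi -> F (outer w chi) = ev (g w) chi.
Proof.
move=> Zp gh; have [m [r [rho db]]] := dual_basis_exists Zp; have [rhoh rE] := db.
have L : linear (fun h : 'Hom(P, Z) => \sum_t ev (g (r t)) (rho t \o h)%VF : K^o).
  move=> k h h'; rewrite scaler_sumr -big_split; apply: eq_bigr => t _ /=.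
  by rewrite comp_lfunDr -comp_lfunZr ev_linear_r.
exists (lfun_of L) => w chi chih; rewrite lfun_ofE.
transitivity (ev (\sum_t ract _ (rho t w) (g (r t))) chi).
  rewrite ev_suml; apply: eq_bigr => t _; rewrite ev_act //; apply: congr1.
  by apply/lfunP => x; rewrite comp_lfunE outerE lscaleE rhoh reg_ractE.
apply: (congr1 (fun xi => ev xi chi)); rewrite [in RHS](rE w) linear_sum; apply: eq_bigr => t _.
by rewrite /= gh.
Qed.

Hypothesis gl : gldim_le A n.

(* The image of Hom(X, A) -> Hom(P_0, A) is a left module direct summand, as it
   is an (n+1)-st syzygy; the retraction is induced by a map q : X -> P_0. *)
Lemma transpose_split :
  exists2 q : 'Hom(C 0, C 1), rhom q &
    (forall chi : 'Hom(C 0, reg), rhom chi -> forall x, chi (d 0 (q x)) = chi x) /\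
    (forall x, q (d 0 (q x)) = q x).
Proof.
(* This is D Hom(X, A), presented as the transpose of a zero map so that [ev] applies. *)
pose V := tau (@rhom0 _ _ (C 0) reg).
have [R Rn] := gl V; have Dd := aug_res R; set D := aug_mod R in Dd; set D_ := aug_d R in Dd.
have [F FE] := cotrace (aug_proj Dd 0) (aug_hom Dd 0 : rhom (D_ 0 : 'Hom(_, V))).
have F0 h : rhom h -> (forall x, D_ 0 (h x) = 0) -> F h = 0.
  move=> hh h0; have [ka kah kaE] := @lift_to_syzygy D D_ Dd Rn h hh h0.
  have [m [r [rho [rhoh rE]]]] := dual_basis_exists (aug_proj Dd 1).
  have -> : h = \sum_t outer (D_ 1 (r t)) (rho t \o ka)%VF.
    apply/lfunP => x; rewrite sum_lfunE -kaE {1}(rE (ka x)) linear_sum.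
    by apply: eq_bigr => t _; rewrite outerE comp_lfunE /= (aug_hom Dd 1).
  rewrite linear_sum /= big1 // => t _; rewrite FE ?(aug_dd Dd); last exact: rhom_comp.
  by rewrite /ev linear0 zero_lfunE.
have TL : linear (fun h : 'Hom(C 0, D 1) => D_ 0 \o h \o d 0 : 'Hom(C 1, V))%VF.
  by move=> k a b; rewrite comp_lfunDr -comp_lfunZr comp_lfunDl -comp_lfunZl.
(* F kills the kernel of h |-> D_0 h d_0 from Hom(X, D 1) to Hom(P_0, V), so it extends to G. Under
   duality G is the retraction Hom(P_0, A) -> Hom(X, A); its values [th i] at a dual basis of P_0
   assemble to q. *)
have [h /homvP hh|G _ GF] := @functional_ext _ _ _ (lfun_of TL) (homv _ _) 0%VS F.
  rewrite lfun_ofE memv0 => /eqP/lfunP h0; apply: F0 => // x.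
  by have [y <-] := aug_surjP Cd x; have := h0 y; rewrite !lfE.
have [m [p [phi db]]] := dual_basis_exists (aug_proj Cd 0); have [ph pE] := db.
have GL i : linear (fun v : V => G (outer v (phi i))).
  move=> k v w; rewrite -linearP; congr (G _); apply/lfunP => x.
  by rewrite !lfE !outerE linearP.
have [th thh thE] := fin_all_exists2 (fun i => ev_rep (lfun_of (GL i))).
pose q : 'Hom(C 0, C 1) := \sum_i outer (p i) (th i).
have qh : rhom q by apply: rhom_sum => i _; apply: rhom_outer.
have qE x : q x = \sum_i ract _ (th i x) (p i).
  by rewrite sum_lfunE; apply: eq_bigr => i _; rewrite outerE.
have chiq (chi : 'Hom(C 0, reg)) : rhom chi -> forall x, chi (d 0 (q x)) = chi x.
  move=> chih; have cdh : rhom (chi \o d 0)%VF by apply: rhom_comp => //; apply: aug_hom.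
  have chiqh : rhom (chi \o d 0 \o q)%VF by apply: rhom_comp.
  suff [phi' _ E] : exists2 phi' : 'Hom(reg, reg), rhom phi' &
      (chi \o d 0 \o q - chi)%VF = (phi' \o (0 : 'Hom(C 0, reg)))%VF.
    move=> x; apply/eqP; rewrite -subr_eq0; move/lfunP/(_ x): E.
    by rewrite !lfE linear0 => ->.
  apply: (@ev_annih _ _ _ _ _ (@rhom0 _ _ (C 0) reg)) => [|v]; first exact: rhomB.
  rewrite /ev !linearB /= -/(ev v _) -/(ev v chi); apply/eqP; rewrite subr_eq0; apply/eqP.
  have -> : (chi \o d 0 \o q)%VF = \sum_i lscale (chi (d 0 (p i))) (th i).
    apply/lfunP => x; rewrite comp_lfunE qE linear_sum sum_lfunE.
    by apply: eq_bigr => i _; rewrite lscaleE /= cdh reg_ractE comp_lfunE.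
  have [w wE] := aug_surjP Dd v.
  transitivity (G (\sum_i outer (ract V (chi (d 0 (p i))) v) (phi i))).
    rewrite ev_sum linear_sum; apply: eq_bigr => i _.
    by rewrite -ev_act // -thE lfun_ofE.
  rewrite -wE -FE // -GF ?lfun_ofE; last exact/homvP/rhom_outer.
  congr (G _); apply/lfunP => x; rewrite sum_lfunE !comp_lfunE outerE (aug_hom Dd 0).
  have := dual_basis_hom db cdh x; rewrite comp_lfunE => ->.
  rewrite [RHS]ract_sum; apply: eq_bigr => i _.
  by rewrite outerE comp_lfunE reg_ractE ractM.
exists q => //; split=> // x.
by rewrite !qE; apply: eq_bigr => i _; rewrite -qE chiq.
Qed.

(** The idempotent d_0 q of the indecomposable X is 0 or 1. If it is 1, X is a retract of P_0; if it
    is 0, every chi : X -> A equals chi d_0 q = 0, and a dual basis passes from A to P. *)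
Lemma hom_reg_eq0 : indecomposable (C 0) -> ~ projective (C 0) ->
  forall (P : rmodule A) (f : 'Hom(C 0, P)), projective P -> rhom f -> forall x, f x = 0.
Proof.
move=> Xi Xnp; have [q qh [chiq qq]] := transpose_split.
have [||E|E] := indecomposable_idem (u := (d 0 \o q)%VF) Xi.
- by apply: rhom_comp => //; apply: aug_hom.
- by move=> x; rewrite !comp_lfunE qq.
- move=> P f Pp fh x; have [m [p [phi [ph pE]]]] := dual_basis_exists Pp.
  rewrite (pE (f x)) big1 // => i _.
  have phf : rhom (phi i \o f)%VF by apply: rhom_comp.
  have := chiq _ phf x; have := E x; rewrite !comp_lfunE => ->.
  by rewrite !linear0 => <-; rewrite ract0.
case: Xnp; apply: retract_proj (aug_proj Cd 0); exists q, (d 0); split=> //.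
  exact: aug_hom.
by move=> x; have := E x; rewrite comp_lfunE.
Qed.

End Bounded.

End HigherAR.

(** * The higher Auslander-Reiten translate *)

Section TauIndecomposable.
Variables (K : fieldType) (A : falgType K).
Implicit Types X Y Z W P Q : rmodule A.
Notation reg := (reg A).

Lemma tau_endo_idem P P' (d : 'Hom(P, P')) (dh : rhom d) (ep : 'Hom(tau dh, tau dh)) f :
  projective P -> projective P' -> rhom f ->
  (forall x, ep (ep x) = ep x) ->
  (forall xi phi, rhom phi -> ev (ep xi) phi = ev xi (phi \o f)%VF) ->
  exists2 s : 'Hom(P', P), rhom s & forall x, f (f x) - f x = s (d x).
Proof.
move=> Pp P'p fh ee fE.
have [||s sh sE] := @tau_endo0 _ _ _ _ _ dh Pp ((f \o f) - f)%VF.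
- by apply: rhomB => //; apply: rhom_comp.
- move=> xi phi ph; rewrite comp_lfunDr comp_lfunNr comp_lfunA /ev !linearB /=.
  by rewrite -/(ev xi _) -/(ev xi (phi \o f)%VF) -!fE ?ee ?subrr //; apply: rhom_comp.
by exists s => // x; rewrite -sE !lfE.
Qed.

(* The Nakayama functor; the codomain of the zero map plays no role. *)
Definition nak X : rmodule A := tau (@rhom0 _ _ X reg).

Lemma nak_indecomposable X : indecomposable X -> projective X -> ~ rzero (nak X) ->
  indecomposable (nak X).
Proof.
move=> Xi Xp Y0; apply: idem_indecomposable => // ep eph ee.
have [f [_ [fh _ _ fE]]] := tau_endo Xp (@reg_hom_projective _ A) eph.
have [s sh sE] := tau_endo_idem Xp (@reg_hom_projective _ A) fh ee fE.
have [x|f0|f1] := indecomposable_idem Xi fh.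
- by apply/eqP; rewrite -subr_eq0 sE zero_lfunE linear0.
- left=> xi; apply: (@ev_inj _ _ _ _ _ (@rhom0 _ _ X reg)) => phi ph; rewrite fE //.
  have -> : (phi \o f)%VF = 0 by apply/lfunP => x; rewrite comp_lfunE f0 linear0 zero_lfunE.
  by rewrite /ev !linear0 zero_lfunE.
right=> xi; apply: (@ev_inj _ _ _ _ _ (@rhom0 _ _ X reg)) => phi ph; rewrite fE //.
by congr (ev _ _); apply/lfunP => x; rewrite comp_lfunE f1.
Qed.

Variables (C : nat -> rmodule A) (d : forall k, 'Hom(C k.+1, C k)).
Hypothesis Cd : augmented d.
Variable n : nat.
Hypothesis Creg : forall j, (j < n)%N -> hom_exact d reg j.
Hypothesis n_gt0 : (0 < n)%N.
Hypothesis Cn : rzero (C n.+2).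
Hypothesis Xreg : forall P (f : 'Hom(C 0, P)), projective P -> rhom f -> forall x, f x = 0.

Let Cn_proj : projective (C n).
Proof. by case: n n_gt0 => // m _; apply: (aug_proj Cd). Qed.

Lemma aug_last_inj x : d n x = 0 -> x = 0.
Proof. by move=> /(aug_exactP Cd)[y <-]; rewrite (Cn y) linear0. Qed.

(** Exactness of Hom extends f' down the complex to X. Each step preserves idempotency up to
    homotopy, and the last two clauses transport the vanishing of u or 1 - u from X back up to
    degree n. *)
Lemma descend_endo (f : 'Hom(C n.+1, C n.+1)) (f' : 'Hom(C n, C n)) :
  rhom f -> rhom f' -> (forall x, f' (d n x) = d n (f x)) ->
  stably_zero d ((f' \o f') - f')%VF ->
  exists u : 'Hom(C 0, C 0),
    [/\ rhom u, stably_zero d ((u \o u) - u)%VF, stably_zero d u -> stably_zero d f'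
      & stably_zero d (\1 - u)%VF -> stably_zero d (\1 - f')%VF].
Proof.
move=> fh f'h ff' fz.
pose Q j := exists u : 'Hom(C j, C j), exists u' : 'Hom(C j.+1, C j.+1),
    [/\ [/\ rhom u, rhom u' & forall x, u (d j x) = d j (u' x)],
      stably_zero d ((u \o u) - u)%VF, stably_zero d u -> stably_zero d f'
      & stably_zero d (\1 - u)%VF -> stably_zero d (\1 - f')%VF].
suff [u [u' [[uh _ _] uz u0 u1]]] : Q 0 by exists u.
have: Q n by exists f', f.
have step j : (j < n)%N -> Q j.+1 -> Q j.
  move=> jn [u [u' [[uh u'h uu'] uz u0 u1]]].
  have Cj : hom_exact d (C j) j.
    case: (j) jn => [|i] jn; first exact: hom_exact0.
    by apply: hom_exact_proj; [exact: (aug_proj Cd) | exact: Creg].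
  have CSj : hom_exact d (C j.+1) j by apply: hom_exact_proj; [exact: (aug_proj Cd) | exact: Creg].
  have [||v vh vE] := Cj (d j \o u)%VF.
  - by apply: rhom_comp => //; apply: aug_hom.
  - by move=> x; rewrite comp_lfunE uu' aug_dd.
  have vE' x : v (d j x) = d j (u x) by rewrite vE comp_lfunE.
  exists v, u; split=> //.
  - apply: (stably_zero_down Cd _ _ CSj uz) => [|x].
      by apply: rhomB => //; apply: rhom_comp.
    by rewrite !lfE !vE' linearB.
  - by move=> vz; apply: u0; apply: (stably_zero_up Cd) vz.
  - move=> vz; apply: u1; apply: (stably_zero_up Cd) vz => [|x].
      by apply: rhomB => //; apply: rhom1.
    by rewrite !lfE vE' linearB.
elim: {1 3}n (leqnn n) => // m IH mn Qm.
by apply: IH; [exact: ltnW | exact: step].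
Qed.

Lemma tau_indecomposable : indecomposable (C 0) -> ~ rzero (tau (aug_hom Cd n)) ->
  indecomposable (tau (aug_hom Cd n)).
Proof.
move=> Xi Y0; apply: idem_indecomposable => // ep eph ee.
have [f [f' [fh f'h ff' fE]]] := tau_endo (aug_proj Cd n) Cn_proj eph.
have [s sh sE] := tau_endo_idem (aug_proj Cd n) Cn_proj fh ee fE.
have [|u [uh [h hh hE] u0 u1]] := descend_endo fh f'h ff'.
  by exists s => // x; rewrite !lfE !ff' -linearB sE.
(* The homotopy h is a map from X to a projective, hence zero: on X idempotency holds strictly. *)
have uu x : u (u x) = u x.
  have [y <-] := aug_surjP Cd x; apply/eqP; rewrite -subr_eq0.
  by have := hE y; rewrite !lfE (Xreg (aug_proj Cd 0) hh) linear0 => ->.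
have [E|E] := indecomposable_idem Xi uh uu.
- left=> xi; apply: (@ev_inj _ _ _ _ _ (aug_hom Cd n)) => phi ph; rewrite fE //.
  have [|k kh kE] := u0.
    by exists 0 => [|x]; rewrite ?E ?zero_lfunE ?linear0 //; apply: rhom0.
  (* Injectivity of [d n] turns d f = f' d = d k d into f = k d, and composites with d pair to
     zero. *)
  have -> : (phi \o f)%VF = ((phi \o k) \o d n)%VF.
    apply/lfunP => x; rewrite !comp_lfunE; congr (phi _).
    by apply/eqP; rewrite -subr_eq0; apply/eqP/aug_last_inj; rewrite linearB /= -ff' kE subrr.
  rewrite ev_pre; last exact: rhom_comp.
  by rewrite /ev linear0 zero_lfunE.
right=> xi; apply: (@ev_inj _ _ _ _ _ (aug_hom Cd n)) => phi ph; rewrite fE //.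
have [|k kh kE] := u1.
  by exists 0 => [|x]; rewrite ?lfE ?E ?subrr ?linear0 //; apply: rhom0.
have -> : (phi \o f)%VF = phi - ((phi \o k) \o d n)%VF.
  apply/lfunP => x; rewrite !lfE -linearB; congr (phi _).
  apply/eqP; rewrite -subr_eq0; apply/eqP/aug_last_inj; rewrite !linearB /= -ff' -kE !lfE.
  by rewrite opprK addKr subrr.
have pkh : rhom (phi \o k)%VF by apply: rhom_comp.
have := ev_pre (dh := aug_hom Cd n) xi pkh; rewrite /ev !linearB /= => ->.
by rewrite subr0.
Qed.

End TauIndecomposable.

(** * Closure of add M under the translates *)

Section ClusterTilting.
Variables (K : fieldType) (A : falgType K) (n : nat) (M : rmodule A).
Implicit Types X Y Z W P Q : rmodule A.
Notation reg := (reg A).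
Hypothesis n_gt0 : (0 < n)%N.
Hypothesis gl : gldim_le A n.
Hypothesis CT : cluster_tilting n M.

Lemma reg_in_add : in_add M reg.
Proof.
by apply/(CT reg).2 => i /andP[i0 _]; apply: Ext_zero_proj => //; apply: reg_hom_projective.
Qed.

Lemma add_hom_exact X (P : resolution X) Z : in_add M X -> in_add M Z ->
  forall j, (j < n)%N -> hom_exact (aug_d P) Z j.
Proof.
move=> XM [k /summand_retract[i [p [ih ph pi]]]] j jn.
apply: (hom_exact_retract ih ph pi); apply: hom_exact_rpow.
case: j jn => [|j] jn; first exact: hom_exact0 (aug_res P) M.
by apply: Ext_zero_hom_exact; apply: (proj1 (proj2 (CT X)) XM).
Qed.

Lemma M_in_add : in_add M M.
Proof.
apply: summand_in_add; exists (rpow M 0).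
apply: (riso_of_bij (@rfst_hom _ _ _ _)) => [[x z]|x].
  by rewrite lfun_ofE /= => ->; rewrite (rpow0_zero z).
by exists (x, 0); rewrite lfun_ofE.
Qed.

(** D Hom(X, A) is injective for projective X: by trace duality, extending maps into it amounts to
    lifting maps out of X. *)
Lemma nak_in_add X : projective X -> in_add M (nak X).
Proof.
move=> Xp; apply/(CT _).1 => i /andP[i0 _].
case: i i0 => // i _; have [R _] := gl M; exists R; apply/hom_exact_atP.
have Dd := aug_res R.
apply: (tau_exact Xp (@reg_hom_projective _ A)); try exact: aug_hom.
move=> al be alh beh E.
have [x|ga gah gaE] := aug_lift Dd Xp alh.
  by rewrite E zero_lfunE linear0.
exists ga, 0 => [|p]; first exact: rhom0.
by rewrite gaE zero_lfunE addr0.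
Qed.

Lemma tau_in_add X (P : resolution X) : in_add M X ->
  in_add M (tau (aug_hom (aug_res P) n)).
Proof.
move=> XM; apply/(CT _).1 => i /andP[i0 iln].
case: i i0 iln => // i _ iln; have [R _] := gl M; exists R; apply/hom_exact_atP.
have Dd := aug_res R; have Cd := aug_res P.
have CD i' j : (j < n)%N -> hom_exact (aug_d P) (aug_mod R i') j.
  case: i' => [|i'] jn; first exact: add_hom_exact XM M_in_add j jn.
  apply: (hom_exact_proj (aug_proj Dd i')).
  exact: add_hom_exact XM reg_in_add j jn.
have Pn : projective (aug_mod P n) by case: (n) n_gt0 => // m _; exact: (aug_proj Cd m).
apply: (tau_exact (aug_proj Cd n) Pn); try exact: aug_hom.
move=> al be alh beh E.
(* With n = m+1 the staircase starts at j = m, the last degree in which Hom(C, -) is exact, and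
   [iln] is the required bound i+1 <= m. *)
have [ga gah gaE] : exists2 ga : 'Hom(aug_mod P n, aug_mod R i.+2), rhom ga &
    forall x, be (aug_d P n x) = aug_d R i.+1 (ga (aug_d P n x)).
  case: n n_gt0 iln CD be beh al alh E => // m _ iln CD be beh al alh E.
  apply: (mixed_cocycle_split Cd Dd CD); rewrite ?ltnSn ?andbT //.
  by move=> x; rewrite /= -E; apply: (aug_dd Dd).
have [||ka kah kaE] := aug_lift Dd (aug_proj Cd n) (f := al - (ga \o aug_d P n)%VF).
- by apply: rhomB => //; apply: rhom_comp => //; apply: aug_hom.
- by move=> x; rewrite !lfE linearB /= -gaE E subrr.
exists ka, ga => // p; rewrite kaE !lfE subrK //.
Qed.

End ClusterTilting.

(** * The Cartan matrix *)

(** In the Leibniz expansion a permutation s with nonzero product never lowers [rk]; the total rank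
    being preserved, it never raises it either, so s is the identity. *)
Lemma unitriangular_unitmx l (rk : 'I_l -> nat) (B : 'M[int]_l) :
  (forall i, B i i = 1) -> (forall i j, i != j -> B i j != 0 -> (rk i < rk j)%N) ->
  B \in unitmx.
Proof.
move=> B1 Brk; rewrite unitmxE; suff -> : \det B = 1 by rewrite unitr1.
rewrite /determinant (bigD1 (1%g : 'S_l)) //= odd_perm1 expr0 mul1r.
rewrite big1 ?mul1r => [|i _]; last by rewrite perm1 B1.
rewrite big1 ?addr0 // => s s1; apply/eqP; rewrite mulf_eq0; apply/orP; right.
apply/prodf_eq0; apply: Classical_Prop.NNPP => nex.
have Bs i : B i (s i) != 0 by apply/negP => B0; apply: nex; exists i.
case/negP: s1; apply/eqP/permP => i; rewrite perm1.
have le j : (rk j <= rk (s j))%N.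
  have [E|ne] := eqVneq j (s j); first by rewrite -E.
  by apply/ltnW/Brk.
have sumE : (\sum_j rk j = \sum_j rk (s j))%N by rewrite (reindex_inj (@perm_inj _ s)).
have /eqP := sumE; have := leqif_sum (fun (j : 'I_l) (_ : true) => leqif_eq (le j)).
move=> /= [_ ->] /forallP/(_ i)/= /eqP rkE.
apply/esym/eqP/negPn/negP => ne.
by have := Brk i (s i) ne (Bs i); rewrite -rkE ltnn.
Qed.

Section QuiverAlgebra.
Variables (K : fieldType) (l : nat) (Q : quiver l) (A : falgType K).
Variables (e : 'I_l -> A) (a : arrow Q -> A).
Hypothesis Qac : acyclic_quiver Q.
Hypothesis bqa : bound_quiver_algebra e a.

Lemma idem_mul i j : e i * e j = if i == j then e i else 0.
Proof. exact: bqa_orth bqa i j. Qed.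

Lemma idemK i : e i * e i = e i.
Proof. by rewrite idem_mul eqxx. Qed.

Lemma peirce_mul i k m j z : e i * (e k * z * e m) * e j =
  (if i == k then e i else 0) * z * (if m == j then e m else 0).
Proof. by rewrite -!idem_mul !mulrA. Qed.

(** A vanishing e_i would be a relation of length 0, outside J^2. *)
Lemma idem_neq0 i : e i != 0.
Proof.
apply/negP => /eqP ei0.
have := @bqa_sub_J2 _ _ _ _ _ _ bqa [:: (i, [::])] (fun=> 1) isT isT.
rewrite big_seq1 /path_image /= ei0 mul0r scaler0 => /(_ erefl (i, [::])).
by rewrite mem_head => /(_ isT isT)/eqP; rewrite oner_eq0.
Qed.

Lemma path_image_end i s : walk (Q := Q) i s ->
  path_image e a (i, s) = e i * path_image e a (i, s) * e (path_end (i, s)).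
Proof.
rewrite /path_image /path_end /= mulrA idemK.
elim: s i => [|x s IH] i /=; first by rewrite big_nil mulr1 idemK.
move=> /andP[/eqP <- sw]; rewrite big_cons.
have axe : a x = a x * e (tgt x).
  by rewrite -[in RHS](bqa_arrow bqa x) -mulrA idemK (bqa_arrow bqa x).
rewrite [in LHS]axe [in RHS]axe -!mulrA; congr (_ * (_ * _)).
by rewrite mulrA -IH.
Qed.

Lemma corner_path i j z : e i * z * e j != 0 ->
  exists2 s, walk (Q := Q) i s & path_end (i, s) = j.
Proof.
have [ps [c [_ /allP pp ->]]] := bqa_surj bqa z.
rewrite mulr_sumr mulr_suml => nz.
have [p pin] : exists2 p, p \in ps & e i * (c p *: path_image e a p) * e j != 0.
  apply/hasP; apply: contraNT nz => /hasPn z0; rewrite big_seq big1 // => p /z0.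
  by rewrite negbK => /eqP.
case: p pin => k s /pp /= sw.
rewrite -scalerAr -scalerAl path_image_end // peirce_mul.
have [ik|_] := eqVneq i k; last by rewrite !mul0r scaler0 eqxx.
case: (path_end _ =P j) => [<- _|_]; last by rewrite mulr0 scaler0 eqxx.
by exists s; rewrite ik.
Qed.

Lemma corner_diag i z : exists c : K, e i * z * e i = c *: e i.
Proof.
have [ps [c [_ /allP pp ->]]] := bqa_surj bqa z.
rewrite mulr_sumr mulr_suml.
have {pp}: {in ps, forall p, exists k : K, e i * (c p *: path_image e a p) * e i = k *: e i}.
  move=> [k s] /pp /= sw; rewrite -scalerAr -scalerAl path_image_end // peirce_mul.
  have [ik|_] := eqVneq i k; last by exists 0; rewrite !mul0r scaler0 scale0r.
  case: (path_end _ =P i) => [pe|_]; last by exists 0; rewrite mulr0 scaler0 scale0r.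
  have s0 : s = [::] by apply: (Qac (p := (k, s))) => //; rewrite pe.
  exists (c (k, [::])); rewrite s0 /path_image /path_end /= big_nil mulr1 ik.
  by rewrite -!mulrA !idemK.
elim: ps => [|p ps IH] H; first by exists 0; rewrite big_nil scale0r.
have [k kE] := H p (mem_head _ _).
have [|m mE] := IH; first by move=> q qin; apply: H; rewrite inE qin orbT.
by exists (k + m); rewrite big_cons kE mE scalerDl.
Qed.

Definition reach i j : bool :=
  if excluded_middle_informative (exists2 s, walk (Q := Q) i s & path_end (i, s) = j)
  then true else false.

Lemma reachP i j : reflect (exists2 s, walk (Q := Q) i s & path_end (i, s) = j) (reach i j).
Proof. by rewrite /reach; case: excluded_middle_informative => H; constructor. Qed.

(** The set of vertices reachable from i shrinks strictly along nontrivial paths, so its size orders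
    the vertices for unitriangularity. *)
Definition height i := #|[pred j | reach i j]|.

Lemma walk_cat i s t : walk (Q := Q) i s -> walk (Q := Q) (path_end (i, s)) t ->
  walk (Q := Q) i (s ++ t).
Proof.
by rewrite /path_end /=; elim: s i => //= x s IH i /andP[-> /IH H] /H.
Qed.

Lemma corner_height i j z : i != j -> e i * z * e j != 0 -> (height j < height i)%N.
Proof.
move=> ij /corner_path[s sw sE].
apply: proper_card; apply/properP; split.
  apply/subsetP => k; rewrite !inE => /reachP[t tw tE]; apply/reachP.
  exists (s ++ t); first by apply: walk_cat => //; rewrite sE.
  rewrite -tE /path_end /= map_cat last_cat -/(path_end (i, s)).
  by move: sE; rewrite /path_end /= => ->.
exists i; rewrite !inE; first by apply/reachP; exists [::].
apply/negP => /reachP[t tw tE].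
have := Qac (p := (i, s ++ t)); rewrite /is_path /path_end /= map_cat last_cat.
move: sE tE; rewrite /path_end /= => sE tE; rewrite sE tE => /(_ _ erefl).
case: s sw sE => [|x s] sw sE; first by move: ij; rewrite -sE eqxx.
by move=> H; have := H (walk_cat sw _); rewrite /path_end /= in sE *; rewrite sE => /(_ tw).
Qed.

Fact corner_linear i j : linear (fun z : A => e i * z * e j).
Proof. by move=> k x y; rewrite mulrDr mulrDl -scalerAr -scalerAl. Qed.

Definition corner i j : {vspace A} := limg (lfun_of (corner_linear i j)).

Lemma cornerP i j z : reflect (e i * z * e j = z) (z \in corner i j).
Proof.
apply: (iffP memv_imgP) => [[x _ ->]|<-].
  by rewrite lfun_ofE !mulrA idemK -mulrA idemK.
by exists z; rewrite ?memvf // lfun_ofE.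
Qed.

Lemma corner_prodv i j : (<[e i]> * {:A} * <[e j]>)%VS = corner i j.
Proof.
apply/eqP; rewrite eqEsubv; apply/andP; split.
  apply/prodvP => u v uA /vlineP[k ->].
  have: u \in limg (amull (e i)).
    move: u uA; apply/subvP; apply/prodvP => _ y /vlineP[m ->] _.
    by apply/memv_imgP; exists (m *: y); rewrite ?memvf // lfunE /= -scalerAr scalerAl.
  move=> /memv_imgP[y _ ->]; apply/cornerP; rewrite lfunE /=.
  by rewrite -!scalerAr !mulrA idemK -!scalerAl -!mulrA idemK.
apply/subvP => _ /memv_imgP[z _ ->]; rewrite lfun_ofE.
by rewrite memv_mul ?memv_line // memv_mul ?memv_line ?memvf.
Qed.

Lemma cartanE i j : cartan e i j = (\dim (corner j i))%:Z.
Proof. by rewrite mxE corner_prodv. Qed.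

Lemma cartan_unit : cartan e \in unitmx.
Proof.
apply: (@unitriangular_unitmx _ height) => [i|i j ij]; rewrite cartanE.
  have -> : corner i i = <[e i]>%VS.
    apply/eqP; rewrite eqEsubv; apply/andP; split; apply/subvP => z.
      by move=> /cornerP <-; have [c ->] := corner_diag i z; rewrite memvZ ?memv_line.
    by move=> /vlineP[k ->]; apply/cornerP; rewrite -scalerAr -scalerAl !idemK.
  by rewrite dim_vline idem_neq0.
move=> nz; have {}nz : vpick (corner j i) != 0.
  by apply: contraNneq nz => /eqP; rewrite vpick0 => /eqP ->; rewrite dimv0.
have zE := cornerP _ _ _ (memv_pick (corner j i)).
by apply: (corner_height (z := vpick (corner j i))); [rewrite eq_sym | rewrite zE].
Qed.

End QuiverAlgebra.

(** * Dimension vectors *)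

Section Dimensions.
Variables (K : fieldType) (l : nat) (Q : quiver l) (A : falgType K).
Variables (e : 'I_l -> A) (a : arrow Q -> A).
Hypothesis Qac : acyclic_quiver Q.
Hypothesis bqa : bound_quiver_algebra e a.
Implicit Types X Y Z P : rmodule A.
Notation reg := (reg A).

Definition piece X i : {vspace X} := limg (ract X (e i)).

Lemma pieceP X i x : reflect (ract X (e i) x = x) (x \in piece X i).
Proof.
apply: (iffP memv_imgP) => [[y _ ->]|<-]; last by exists x; rewrite ?memvf.
by rewrite -ractM (idemK bqa).
Qed.

Fact lscale_r_linear P b : linear (fun phi : 'Hom(P, reg) => lscale b phi).
Proof.
by move=> k f g; apply/lfunP => x; rewrite !lscaleE !lfE !lscaleE mulrDr scalerAr.
Qed.

Definition dual_piece P i : {vspace 'Hom(P, reg)} :=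
  (lfun_of (@lscale_r_linear P (e i)) @: homv P reg)%VS.

Lemma dual_pieceP P i (phi : 'Hom(P, reg)) :
  reflect (rhom phi /\ lscale (e i) phi = phi) (phi \in dual_piece P i).
Proof.
apply: (iffP memv_imgP) => [[psi /homvP psih ->]|[ph <-]].
  rewrite lfun_ofE; split; first exact: rhom_lscale.
  by apply/lfunP => x; rewrite !lscaleE mulrA (idemK bqa).
by exists phi; [apply/homvP | rewrite lfun_ofE].
Qed.

Fact precomp_linear P P' (d : 'Hom(P, P')) :
  linear (fun phi : 'Hom(P', reg) => (phi \o d)%VF).
Proof. by move=> k f g; rewrite comp_lfunDl comp_lfunZl. Qed.

Definition precomp P P' (d : 'Hom(P, P')) : 'Hom('Hom(P', reg), 'Hom(P, reg)) :=
  lfun_of (precomp_linear d).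

Lemma precompE P P' (d : 'Hom(P, P')) phi : precomp d phi = (phi \o d)%VF.
Proof. exact: lfun_ofE. Qed.

Lemma lscale_comp P P' (d : 'Hom(P, P')) b (phi : 'Hom(P', reg)) :
  lscale b (phi \o d)%VF = (lscale b phi \o d)%VF.
Proof. by apply/lfunP => x; rewrite lscaleE !comp_lfunE lscaleE. Qed.

(** [ev] restricts to a perfect pairing between tau e_i and e_i Hom(P, A) modulo the image of e_i
    Hom(P', A). *)
Lemma dim_tau P P' (d : 'Hom(P, P')) (dh : rhom d) i :
  (\dim (piece (tau dh) i) + \dim (precomp d @: dual_piece P' i) =
   \dim (dual_piece P i))%N.
Proof.
pose Y := subvs_of (piece (tau dh) i).
have evL phi : linear (fun y : Y => ev (vsval y) phi : K^o).
  by move=> k y z; rewrite linearP ev_linear_l.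
have TL : linear (fun phi : 'Hom(P, reg) => lfun_of (evL phi)).
  move=> k f g; apply/lfunP => y; rewrite !lfE !lfun_ofE.
  exact: ev_linear_r.
rewrite -(limg_ker_dim (lfun_of TL) (dual_piece P i)) addnC; congr (_ + _)%N.
  congr (\dim _); apply/vspaceP => phi; apply/idP/idP.
    move=> /memv_imgP[psi /dual_pieceP[psih psie] ->]; rewrite precompE.
    apply/memv_capP; split.
      by apply/dual_pieceP; split; [apply: rhom_comp | rewrite lscale_comp psie].
    rewrite memv_ker lfun_ofE; apply/eqP/lfunP => y.
    by rewrite lfun_ofE ev_pre // zero_lfunE.
  move=> /memv_capP[/dual_pieceP[ph phe]].
  rewrite memv_ker lfun_ofE => /eqP/lfunP ph0.
  have [xi|psi psih psiE] := @ev_annih _ _ _ _ _ dh phi ph.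
    rewrite -phe -ev_act //.
    have yP : ract _ (e i) xi \in piece (tau dh) i by rewrite memv_img ?memvf.
    by have := ph0 (vsproj _ (ract _ (e i) xi)); rewrite lfun_ofE zero_lfunE vsprojK.
  apply/memv_imgP; exists (lscale (e i) psi); last by rewrite precompE -lscale_comp -psiE.
  apply/dual_pieceP; split; first exact: rhom_lscale.
  by apply/lfunP => x; rewrite !lscaleE mulrA (idemK bqa).
suff -> : (lfun_of TL @: dual_piece P i = fullv)%VS.
  by rewrite dimvf; rewrite /dim /= muln1.
apply/eqP; rewrite eqEsubv subvf /=; apply/subvP => L _.
have L'L : linear (fun xi : tau dh => L (vsproj (piece (tau dh) i) (ract _ (e i) xi))).
  by move=> k x y; rewrite !linearP.
have [phi ph phiE] := ev_rep (lfun_of L'L).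
apply/memv_imgP; exists (lscale (e i) phi).
  apply/dual_pieceP; split; first exact: rhom_lscale.
  by apply/lfunP => x; rewrite !lscaleE mulrA (idemK bqa).
rewrite lfun_ofE; apply/lfunP => y; rewrite lfun_ofE -ev_act // -phiE lfun_ofE.
have E : ract (tau dh) (e i) (vsval y) = vsval y by apply/pieceP; apply: subvsP.
by rewrite !E vsvalK.
Qed.

Lemma sum_idem X (x : X) : x = \sum_i ract X (e i) x.
Proof. by rewrite -ract_sum (bqa_unit bqa) ract1. Qed.

(** The data exhibit e_j A as a summand of P. Without them all e_j phi(x) e_j vanish, these corners
    being at most lines K e_j. Then x e_i is a sum of terms p_t e_j phi_t(x) e_i in which only j of
    larger height survive; heights are at most l, so descending induction kills P. *)
Lemma proj_cyclic_summand P : projective P -> ~ rzero P ->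
  exists j (x : P) (phi : 'Hom(P, reg)),
    [/\ rhom phi, lscale (e j) phi = phi, ract P (e j) x = x & phi x = e j].
Proof.
move=> Pp P0; apply: Classical_Prop.NNPP => nex; apply: P0 => x0.
have key j (x : P) (phi : 'Hom(P, reg)) : rhom phi -> e j * (phi x : A) * e j = 0.
  move=> ph; have [c cE] := corner_diag Qac bqa j (phi x).
  have [c0|c0] := eqVneq c 0; first by rewrite cE c0 scale0r.
  case: nex; exists j, (ract P (e j) x), (c^-1 *: lscale (e j) phi); split.
  - by apply: rhomZ; apply: rhom_lscale.
  - by apply/lfunP => y; rewrite lscaleE !scale_lfunE lscaleE -scalerAr mulrA (idemK bqa).
  - by rewrite -ractM (idemK bqa).
  by rewrite scale_lfunE lscaleE ph reg_ractE mulrA cE scalerA mulVf // scale1r.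
have [m [p [phi [ph pE]]]] := dual_basis_exists Pp.
have H k i : (l < height Q i + k)%N -> forall x : P, ract P (e i) x = 0.
  elim: k i => [|k IH] i ik x.
    by move: ik; rewrite addn0 ltnNge -[X in (_ <= X)%N]card_ord max_card.
  rewrite [x]pE linear_sum big1 // => t _ /=; rewrite -ractM.
  rewrite -[phi t x]mul1r -(bqa_unit bqa) !mulr_suml ract_sum big1 // => j _.
  have [<-|ji] := eqVneq j i; first by rewrite key ?ract0.
  have [->|nz] := eqVneq (e j * phi t x * e i) 0; first exact: ract0.
  rewrite -mulrA ractM IH ?linear0 //.
  apply: leq_trans ik _; rewrite addnS -addSn leq_add2r.
  exact: (corner_height Qac bqa ji nz).
by rewrite (sum_idem x0) big1 // => i _; apply: (H l.+1); rewrite addnS ltnS leq_addl.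
Qed.

Lemma dim_piece_ker X Y (f : 'Hom(X, Y)) (fh : rhom f) i :
  (\dim (piece (rsub (lker_stable fh)) i) + \dim (f @: piece X i) = \dim (piece X i))%N.
Proof.
rewrite -(limg_ker_dim f (piece X i)); congr (_ + _)%N.
have incl0 : lker (rsub_incl (lker_stable fh)) == 0%VS by apply/lker0P/rsub_incl_inj.
rewrite -(limg_dim_eq (f := rsub_incl (lker_stable fh))); last first.
  by rewrite (eqP incl0) capv0.
congr (\dim _); apply/vspaceP => x; apply/memv_imgP/memv_capP.
  move=> [y /pieceP yE ->]; split; last exact: rsub_incl_mem.
  by apply/pieceP; rewrite -rsub_incl_hom yE.
move=> [/pieceP xE xk]; have [y yE] := rsub_lift (lker_stable fh) xk.
exists y => //; apply/pieceP; apply: (rsub_incl_inj (Ust := lker_stable fh)).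
by rewrite rsub_incl_hom yE.
Qed.

(** * Splitting off a summand e_j A *)

Section CyclicSummand.
Variables (P : rmodule A) (j : 'I_l) (x : P) (phi : 'Hom(P, reg)).
Hypothesis ph : rhom phi.
Hypothesis phe : lscale (e j) phi = phi.
Hypothesis xe : ract P (e j) x = x.
Hypothesis phx : phi x = e j.
Let N := rsub (lker_stable ph).
Let incl : 'Hom(N, P) := rsub_incl (lker_stable ph).

Lemma phi_idl p : e j * (phi p : A) = phi p.
Proof. by rewrite -[in RHS]phe lscaleE. Qed.

Lemma cyclic_retraction : exists2 r : 'Hom(P, N), rhom r &
  forall p, incl (r p) = p - ract P (phi p) x.
Proof.
have [|p|r rh rE] := @rsub_corestrict _ _ _ _ (lker_stable ph) _ (\1 - outer x phi)%VF.
- by apply: rhomB; [apply: rhom1 | apply: rhom_outer].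
- rewrite memv_ker !lfE outerE linearB /= ph phx reg_ractE.
  by rewrite phi_idl subrr.
by exists r => // p; rewrite rE !lfE outerE.
Qed.

Lemma incl_ker y : phi (incl y) = 0.
Proof. by apply/eqP; rewrite -memv_ker rsub_incl_mem. Qed.

Lemma complement_retract : retract N P.
Proof.
have [r rh rE] := cyclic_retraction; exists incl, r; split=> // [|y].
  exact: rsub_incl_hom.
by apply: (rsub_incl_inj (Ust := lker_stable ph)); rewrite rE incl_ker ract0 subr0.
Qed.

Lemma dim_piece_cyclic i : (\dim (piece N i) + \dim (corner e j i) = \dim (piece P i))%N.
Proof.
rewrite -(dim_piece_ker ph); congr (_ + \dim _)%N.
apply/vspaceP => z; apply/(cornerP bqa)/memv_imgP => [zE|[p /pieceP pE ->]].
  exists (ract P (z : A) x); last by rewrite ph phx reg_ractE -zE !mulrA (idemK bqa).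
  by apply/pieceP; rewrite -ractM -zE -mulrA (idemK bqa).
by rewrite phi_idl -[in RHS]pE ph reg_ractE.
Qed.

Lemma dim_dual_piece_cyclic i :
  (\dim (dual_piece N i) + \dim (corner e i j) = \dim (dual_piece P i))%N.
Proof.
have [r rh rE] := cyclic_retraction.
rewrite -(limg_ker_dim (precomp incl) (dual_piece P i)) addnC; congr (_ + _)%N; last first.
  congr (\dim _); apply/vspaceP => psi; apply/idP/memv_imgP.
    move=> /dual_pieceP[psih psie]; exists (psi \o r)%VF.
      by apply/dual_pieceP; split; [apply: rhom_comp | rewrite lscale_comp psie].
    rewrite precompE; apply/lfunP => y; rewrite !comp_lfunE; congr (psi _).
    apply: (rsub_incl_inj (Ust := lker_stable ph)).
    by rewrite rE incl_ker ract0 subr0.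
  move=> [chi /dual_pieceP[chih chie] ->]; rewrite precompE; apply/dual_pieceP.
  by split; [apply: rhom_comp => //; apply: rsub_incl_hom | rewrite lscale_comp chie].
have TL : linear (fun z : A => lscale z phi).
  by move=> k z w; apply/lfunP => p; rewrite !lfE !lscaleE mulrDl scalerAl.
rewrite -(limg_dim_eq (f := lfun_of TL)); last first.
  apply/eqP; rewrite -subv0; apply/subvP => z /memv_capP[/(cornerP bqa) zE].
  rewrite memv_ker lfun_ofE memv0 => /eqP/lfunP/(_ x).
  by rewrite lscaleE phx zero_lfunE -zE -mulrA (idemK bqa) => ->.
congr (\dim _); apply/vspaceP => psi; apply/memv_imgP/memv_capP.
  move=> [z /(cornerP bqa) zE ->]; rewrite lfun_ofE; split.
    apply/dual_pieceP; split; first exact: rhom_lscale.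
    apply/lfunP => p; rewrite !lscaleE -zE.
    by rewrite !mulrA (idemK bqa).
  rewrite memv_ker precompE; apply/eqP/lfunP => y.
  by rewrite comp_lfunE lscaleE incl_ker mulr0 zero_lfunE.
move=> [/dual_pieceP[psih psie]]; rewrite memv_ker precompE => /eqP/lfunP psi0.
exists (psi x : A).
  apply/(cornerP bqa).
  have -> : e i * (psi x : A) = psi x by rewrite -[in RHS]psie lscaleE.
  by rewrite -{1}xe psih reg_ractE -mulrA (idemK bqa) -reg_ractE -psih xe.
rewrite lfun_ofE; apply/lfunP => p; rewrite lscaleE.
have := psi0 (r p); rewrite comp_lfunE rE zero_lfunE linearB /= => /eqP.
by rewrite subr_eq0 psih reg_ractE => /eqP.
Qed.

Lemma complement_smaller : (\dim {:N} < \dim {:P})%N.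
Proof.
have := limg_ker_dim phi fullv; rewrite capfv => <-.
rewrite [X in (X < _)%N]dimvf /= -[X in (X < _)%N]addn0 ltn_add2l lt0n dimv_eq0.
apply/eqP => im0; have := idem_neq0 bqa j; rewrite -phx.
by rewrite -memv0 -im0 memv_img ?memvf.
Qed.

End CyclicSummand.

Definition dual_dimv P : 'cV[int]_l := \col_i (\dim (dual_piece P i))%:Z.

(** The vector u counts the summands e_j A of P: column j of the Cartan matrix is the dimension
    vector of e_j A, and column j of its transpose that of A e_j = Hom(e_j A, A). *)
Lemma proj_dim_vectors P : projective P -> exists u : 'cV[int]_l,
  dimv e P = cartan e *m u /\ dual_dimv P = (cartan e)^T *m u.
Proof.
have [m] := ubnP (\dim {:P}); elim: m P => // m IH P; rewrite ltnS => Pm Pp.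
have [P0|P0] := excluded_middle_informative (rzero P).
  exists 0; rewrite !mulmx0; split; apply/colP => i; rewrite !mxE.
    by rewrite limg0_rzero ?dimv0.
  suff -> : dual_piece P i = 0%VS by rewrite dimv0.
  apply/eqP; rewrite -subv0; apply/subvP => psi _; rewrite memv0; apply/eqP/lfunP => y.
  by rewrite (P0 y) !linear0.
have [j [x [phi [ph phe xe phx]]]] := proj_cyclic_summand Pp P0.
have [||u [uE uE']] := IH (rsub (lker_stable ph)).
- exact: leq_trans (complement_smaller ph phx) Pm.
- exact: retract_proj (complement_retract ph phe phx) Pp.
exists (u + delta_mx j 0); rewrite !mulmxDr -uE -uE' -!colE.
split; apply/colP => i; rewrite !mxE.
  rewrite -(dim_piece_cyclic ph phe phx i) PoszD; congr (_ + _).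
  by rewrite -(cartanE bqa) mxE.
rewrite -(dim_dual_piece_cyclic ph phe xe phx i) PoszD; congr (_ + _).
by rewrite -(cartanE bqa) mxE.
Qed.

(* The Coxeter transformation without its sign. *)
Definition psi_mx : 'M[int]_l := (cartan e)^T *m invmx (cartan e).

Lemma dual_dimv_proj P : projective P -> dual_dimv P = psi_mx *m dimv e P.
Proof.
move=> /proj_dim_vectors[u [-> ->]].
by rewrite /psi_mx mulmxA mulmxKV ?(cartan_unit Qac bqa).
Qed.

Lemma dimv_eq0_rzero X : dimv e X = 0 -> rzero X.
Proof.
move=> /colP X0 x; rewrite (sum_idem x) big1 // => i _.
have := X0 i; rewrite !mxE => /eqP; rewrite eqz_nat dimv_eq0 => /eqP E.
by apply/eqP; rewrite -memv0 -E memv_img ?memvf.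
Qed.

Lemma dimv_nak X : dimv e (nak X) = dual_dimv X.
Proof.
apply/colP => i; rewrite !mxE; congr Posz.
rewrite -(dim_tau (@rhom0 _ _ X reg)).
suff -> : (precomp (0 : 'Hom(X, reg)) @: dual_piece reg i = 0)%VS by rewrite dimv0 addn0.
apply/eqP; rewrite -subv0; apply/subvP => _ /memv_imgP[psi _ ->].
by rewrite precompE comp_lfun0r mem0v.
Qed.

Lemma dimv_retract X Y i : retract X Y -> dimv e X i 0 <= dimv e Y i 0.
Proof.
move=> [f [p [fh ph pf]]]; rewrite !mxE lez_nat.
have f0 : lker f == 0%VS.
  by apply/lker0P => x y fxy; rewrite -(pf x) fxy pf.
rewrite -(limg_dim_eq (f := f)) ?(eqP f0) ?capv0 //; apply: dimvS.
by apply/subvP => _ /memv_imgP[x /pieceP xE ->]; apply/pieceP; rewrite -fh xE.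
Qed.

(** * Alternating sums along an augmented resolution *)

Section AugDimensions.
Variables (C : nat -> rmodule A) (d : forall k, 'Hom(C k.+1, C k)).
Hypothesis Cd : augmented d.
Variable n : nat.
Hypothesis Creg : forall j, (j < n)%N -> hom_exact d reg j.
Hypothesis Cn : rzero (C n.+2).
Hypothesis Xreg : forall f : 'Hom(C 0, reg), rhom f -> forall x, f x = 0.

Let s k : 'cV[int]_l := \col_i (\dim (d k @: piece (C k.+1) i))%:Z.
Let r k : 'cV[int]_l := \col_i (\dim (precomp (d k) @: dual_piece (C k) i))%:Z.

Lemma syzygy_dim0 : s 0 = dimv e (C 0).
Proof.
apply/colP => i; rewrite !mxE; congr Posz; congr (\dim _).
apply/vspaceP => y; apply/memv_imgP/pieceP => [[x /pieceP xE ->]|yE].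
  by rewrite -(aug_hom Cd) xE.
have [x xE] := aug_surjP Cd y; exists (ract _ (e i) x); first by rewrite memv_img ?memvf.
by rewrite (aug_hom Cd) xE yE.
Qed.

Lemma syzygy_dimS k : s k.+1 + s k = dimv e (C k.+1).
Proof.
apply/colP => i; rewrite !mxE -PoszD -[\dim (limg (ract _ _))](limg_ker_dim (d k)).
congr Posz; congr (_ + _)%N; congr (\dim _); apply/vspaceP => y; apply/memv_imgP/memv_capP.
  move=> [x /pieceP xE ->]; split; last by rewrite memv_ker aug_dd.
  by apply/pieceP; rewrite -(aug_hom Cd) xE.
move=> [/pieceP yE]; rewrite memv_ker => /eqP/(aug_exactP Cd)[x xE].
exists (ract _ (e i) x); first by rewrite memv_img ?memvf.
by rewrite (aug_hom Cd) xE yE.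
Qed.

Lemma syzygy_dim_last : s n = dimv e (C n.+1).
Proof.
rewrite -syzygy_dimS -[LHS]add0r; congr (_ + _); apply/colP => i; rewrite !mxE.
suff -> : (d n.+1 @: piece (C n.+2) i)%VS = 0%VS by rewrite dimv0.
apply/eqP; rewrite -subv0; apply: subv_trans (limgS _ (subvf _)) _.
by rewrite limg0_rzero ?subvv.
Qed.

Lemma dual_syzygy_dim0 : r 0 = 0.
Proof.
apply/colP => i; rewrite !mxE.
suff -> : dual_piece (C 0) i = 0%VS by rewrite limg0 dimv0.
apply/eqP; rewrite -subv0; apply/subvP => f /dual_pieceP[fh _].
by rewrite memv0; apply/eqP/lfunP => x; rewrite Xreg ?zero_lfunE.
Qed.

Lemma dual_syzygy_dimS k : (k < n)%N -> r k.+1 + r k = dual_dimv (C k.+1).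
Proof.
move=> kn; apply/colP => i; rewrite !mxE -PoszD.
rewrite -(limg_ker_dim (precomp (d k.+1)) (dual_piece (C k.+1) i)) addnC.
congr Posz; congr (_ + _)%N; congr (\dim _); apply/vspaceP => f; apply/memv_imgP/memv_capP.
  move=> [g /dual_pieceP[gh ge] ->]; rewrite precompE; split.
    apply/dual_pieceP; split; first by apply: rhom_comp => //; apply: aug_hom.
    by rewrite lscale_comp ge.
  rewrite memv_ker precompE; apply/eqP/lfunP => x.
  by rewrite !comp_lfunE aug_dd // linear0 zero_lfunE.
move=> [/dual_pieceP[fh fe]]; rewrite memv_ker precompE => /eqP/lfunP fd.
have [x|g gh gE] := Creg kn fh; first by have := fd x; rewrite comp_lfunE zero_lfunE.
exists (lscale (e i) g).
  apply/dual_pieceP; split; first exact: rhom_lscale.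
  by apply/lfunP => x; rewrite !lscaleE mulrA (idemK bqa).
rewrite precompE -lscale_comp -[LHS]fe; congr (lscale _ _).
by apply/lfunP => x; rewrite comp_lfunE gE.
Qed.

Lemma dimv_tau : dimv e (tau (aug_hom Cd n)) = (-1) ^+ n *: psi_mx *m dimv e (C 0).
Proof.
have E (x y z : 'cV[int]_l) : x + y - (y - z) = x + z.
  by rewrite opprB addrA addrAC addrK.
(* Both r and psi s satisfy the recursion with right-hand side psi dim P_k, so their difference only
   alternates in sign; it starts at psi s_0 because r_0 = 0. *)
have rE k : (k <= n)%N -> r k = psi_mx *m s k - (-1) ^+ k *: (psi_mx *m s 0).
  elim: k => [|k IH] kn; first by rewrite dual_syzygy_dim0 expr0 scale1r subrr.
  have := dual_syzygy_dimS kn; rewrite (dual_dimv_proj (aug_proj Cd k)) -syzygy_dimS.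
  rewrite IH ?(ltnW kn) // mulmxDr => /(canRL (addrK _)) ->.
  by rewrite E exprS mulN1r scaleNr opprK.
have tE : dimv e (tau (aug_hom Cd n)) + r n = dual_dimv (C n.+1).
  by apply/colP => i; rewrite !mxE -PoszD dim_tau.
move: tE; rewrite rE // (dual_dimv_proj (aug_proj Cd n)) -syzygy_dim_last.
move/(canRL (addrK _)) ->; rewrite opprB addrCA subrr addr0.
by rewrite syzygy_dim0 -scalemxAl.
Qed.

End AugDimensions.

End Dimensions.

(** * Orbits of the Coxeter transformation *)

Section IntegerPowers.
Variables (l : nat) (Phi : 'M[int]_l).
Implicit Types x : 'cV[int]_l.

Lemma iter_mulmx_one k x : iter k (mulmx Phi) 1%:M *m x = iter k (mulmx Phi) x.
Proof. by elim: k => [|k IH] /=; rewrite ?mul1mx // -mulmxA IH. Qed.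

Hypothesis Phi_unit : Phi \in unitmx.

Lemma iter_mulmx_inj k : injective (iter k (mulmx Phi) : 'cV[int]_l -> 'cV[int]_l).
Proof.
elim: k => [|k IH] x y //= /(congr1 (mulmx (invmx Phi))).
by rewrite !mulKmx // => /IH.
Qed.

Lemma iter_inv_mulmx k m x : (k <= m)%N ->
  iter k (mulmx (invmx Phi)) (iter m (mulmx Phi) x) = iter (m - k) (mulmx Phi) x.
Proof.
elim: k m => [|k IH] m km; first by rewrite subn0.
by case: m km => // m km; rewrite iterSr iterS mulKmx // subSS IH.
Qed.

Lemma int_box_finite (b : 'cV[int]_l) (f : nat -> 'cV[int]_l) :
  (forall m i, `|f m i 0| <= b i 0) -> exists k m, (k < m)%N /\ f k = f m.
Proof.
move=> fb; pose B := (\max_i `|b i 0%R|)%N.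
have fB m i : (`|f m i 0%R| <= B)%N.
  have := leq_bigmax (F := fun i => `|b i 0%R|%N) i; rewrite -/B.
  by have := fb m i; lia.
(* Adding B turns entries between -B and B into indices up to B + B, ready for the pigeonhole
   principle. *)
pose c m : {ffun 'I_l -> 'I_(B + B).+1} := [ffun i => inord `|(f m i 0 + B%:Z)%R|%N].
have cinj k m : c k = c m -> f k = f m.
  move=> /ffunP ckm; apply/colP => i.
  have := congr1 val (ckm i); rewrite !ffunE /= !inordK.
  1-3: by have := fB m i; have := fB k i; lia.
pose N := #|{: {ffun 'I_l -> 'I_(B + B).+1}}|.
have /injectivePn[k [m km ckm]] : ~~ injectiveb (fun k : 'I_N.+1 => c k).
  by apply/negP => /injectiveP/leq_card; rewrite card_ord ltnn.
move: km; rewrite neq_ltn => /orP[km|mk]; first by exists k, m; split; [|apply: cinj].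
by exists m, k; split; [|apply/esym/cinj].
Qed.

(** A bounded forward orbit of integer vectors repeats, and by injectivity it returns to x; negative
    powers then act on x as positive ones. *)
Lemma mxpowz_orbit (b : 'cV[int]_l) (T : 'cV[int]_l -> Prop) :
  (forall x, T x -> T (Phi *m x)) -> (forall x, T x -> forall i, `|x i 0| <= b i 0) ->
  forall x, T x -> forall m, T (mxpowz Phi m *m x).
Proof.
move=> TP Tb x Tx.
have Ti k : T (iter k (mulmx Phi) x) by elim: k => //= k IH; apply: TP.
case=> k /=; first by rewrite iter_mulmx_one.
have [k1 [k2 [k12 E]]] := int_box_finite (fun m => Tb _ (Ti m)).
have {E} Ep : iter (k2 - k1) (mulmx Phi) x = x.
  by apply: (@iter_mulmx_inj k1); rewrite -iterD subnKC ?E // ltnW.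
have {k12} p0 : (0 < k2 - k1)%N by rewrite subn_gt0.
have EN N : iter (N * (k2 - k1)) (mulmx Phi) x = x.
  by elim: N => // N IH; rewrite mulSn iterD IH.
(* The multiple (k+1)p of the period p >= 1 is at least k+1, enough to absorb the k+1 inverse
   steps. *)
have -> : invmx Phi *m iter k (mulmx (invmx Phi)) 1%:M *m x =
          iter (k.+1 * (k2 - k1) - k.+1) (mulmx Phi) x.
  rewrite -iter_inv_mulmx ?leq_pmulr // EN.
  elim: k => [|k IH] /=; first by rewrite mulmx1.
  by rewrite -!mulmxA in IH *; rewrite IH.
exact: Ti.
Qed.

End IntegerPowers.

(** * Dimension vectors of the indecomposables in add M *)

Section ClusterVectors.
Variables (K : fieldType) (l : nat) (Q : quiver l) (A : falgType K).
Variables (e : 'I_l -> A) (a : arrow Q -> A) (n : nat) (M : rmodule A).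
Hypothesis Qac : acyclic_quiver Q.
Hypothesis bqa : bound_quiver_algebra e a.
Hypothesis n_gt0 : (0 < n)%N.
Hypothesis gl : gldim_le A n.
Hypothesis CT : cluster_tilting n M.

Lemma coxeterE : coxeter e n = (-1) ^+ n *: psi_mx e.
Proof. by []. Qed.

Lemma psi_unit : psi_mx e \in unitmx.
Proof.
have := cartan_unit Qac bqa.
by rewrite /psi_mx unitmx_mul unitmx_tr unitmx_inv => ->.
Qed.

Lemma coxeter_unit : coxeter e n \in unitmx.
Proof.
rewrite coxeterE -mul_scalar_mx unitmx_mul psi_unit andbT.
by rewrite unitmxE det_scalar !unitrX ?unitrN1.
Qed.

Lemma psi_mx_neq0 (x : 'cV[int]_l) : x != 0 -> psi_mx e *m x != 0.
Proof.
apply: contraNneq => E; apply/eqP; rewrite -[x](mulKmx psi_unit) E.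
by rewrite mulmx0.
Qed.

Lemma dimv_neq0 X : ~ rzero X -> dimv e X != 0.
Proof. by move=> X0; apply/eqP => /(dimv_eq0_rzero bqa). Qed.

Lemma coxeter_cluster X : indecomposable X -> in_add M X ->
  exists2 Y, indecomposable Y /\ in_add M Y &
    coxeter e n *m dimv e X = dimv e Y \/
    coxeter e n *m dimv e X = (-1) ^+ n *: dimv e Y.
Proof.
move=> Xi XM; have X0 := proj1 Xi.
have [Xp|Xnp] := excluded_middle_informative (projective X).
  have nakE : dimv e (nak X) = psi_mx e *m dimv e X.
    by rewrite (dimv_nak bqa) (dual_dimv_proj Qac bqa).
  exists (nak X); last by right; rewrite nakE coxeterE -scalemxAl.
  split; last exact: (nak_in_add gl CT).
  (* If nu X were zero, the invertible [psi_mx] would kill the nonzero vector dim X. *)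
  apply: nak_indecomposable => // Y0; have := psi_mx_neq0 (dimv_neq0 X0).
  rewrite -nakE => /eqP[]; apply/colP => i; rewrite !mxE.
  by rewrite limg0_rzero ?dimv0.
have [P Pn] := gl X; have Cd := aug_res P.
have Creg j : (j < n)%N -> hom_exact (aug_d P) (reg A) j.
  exact: (add_hom_exact CT XM (reg_in_add CT)).
have Cn : rzero (aug_mod P n.+2) by apply: Pn.
have Xreg := hom_reg_eq0 Cd Creg gl Xi Xnp.
have tE : dimv e (tau (aug_hom Cd n)) = coxeter e n *m dimv e X.
  apply: (dimv_tau Qac bqa Cd Creg Cn) => f fh x.
  by apply: Xreg => //; apply: reg_hom_projective.
exists (tau (aug_hom Cd n)); last by left.
split; last exact: (tau_in_add n_gt0 gl CT).
apply: (tau_indecomposable Creg n_gt0 Cn Xreg Xi) => Y0.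
have := psi_mx_neq0 (dimv_neq0 X0); rewrite coxeterE -scalemxAl in tE.
have {tE} : (-1) ^+ n *: (psi_mx e *m dimv e X) = 0.
  by rewrite -tE; apply/colP => i; rewrite !mxE limg0_rzero ?dimv0.
move/(congr1 (GRing.scale ((-1) ^+ n))).
by rewrite scalerA -expr2 sqrr_sign scale1r scaler0 => ->; rewrite eqxx.
Qed.

Definition cluster_vec (x : 'cV[int]_l) : Prop :=
  exists2 X : rmodule A, indecomposable X /\ in_add M X & x = dimv e X.

Lemma cluster_vec_coxeter x : cluster_vec x ->
  exists2 y, cluster_vec y & coxeter e n *m x = y \/ coxeter e n *m x = (-1) ^+ n *: y.
Proof.
move=> [X [Xi XM] ->]; have [Y YM YE] := coxeter_cluster Xi XM.
by exists (dimv e Y) => //; exists Y.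
Qed.

Lemma cluster_vec_ge0 x : cluster_vec x -> nonneg_vec x.
Proof. by move=> [X _ ->] i; rewrite mxE. Qed.

(** The bound is uniform because X is a retract of M itself and not just of some power. *)
Lemma cluster_vec_bound x i : cluster_vec x -> x i 0 <= dimv e M i 0.
Proof.
by move=> [X [Xi XM] ->]; apply: (dimv_retract bqa); apply: in_add_retract.
Qed.

Lemma cluster_vec_pow x : cluster_vec x -> forall m : int,
  cluster_vec (mxpowz (coxeter e n) m *m x) \/
  cluster_vec ((-1) ^+ n *: (mxpowz (coxeter e n) m *m x)).
Proof.
(* Closing under the sign (-1)^n makes the set stable under the Coxeter transformation without
   losing the bound. *)
move=> xC; pose T y := cluster_vec y \/ cluster_vec ((-1) ^+ n *: y).
have sgnK (y : 'cV[int]_l) : (-1) ^+ n *: ((-1) ^+ n *: y) = y.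
  by rewrite scalerA -expr2 sqrr_sign scale1r.
apply: (mxpowz_orbit coxeter_unit (b := dimv e M) (T := T)); last by left.
- move=> y [/cluster_vec_coxeter[z zC [->|->]]|/cluster_vec_coxeter[z zC]]; rewrite /T.
  + by left.
  + by right; rewrite sgnK.
  rewrite -scalemxAr => -[E|/(congr1 (GRing.scale ((-1) ^+ n)))].
    by right; rewrite E.
  by rewrite !sgnK => ->; left.
- move=> y [] yC i.
    by rewrite ger0_norm ?(cluster_vec_ge0 yC) ?cluster_vec_bound.
  rewrite -[y]sgnK mxE normrM normr_sign mul1r.
  by rewrite ger0_norm ?(cluster_vec_ge0 yC) ?cluster_vec_bound.
Qed.

End ClusterVectors.

Theorem theorem1p5 (K : closedFieldType) (l : nat) (Q : quiver l)
  (A : falgType K) (e : 'I_l -> A) (a : arrow Q -> A) (n : nat) :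
  connected_quiver Q -> acyclic_quiver Q -> bound_quiver_algebra e a ->
  (1 <= n)%N -> representation_finite A n ->
  (forall x : 'cV[int]_l, cluster_root e n x -> sign_coherent (coxeter e n) x) /\
  (~~ odd n -> forall x : 'cV[int]_l,
     cluster_root e n x -> phi_positive (coxeter e n) x).
Proof.
move=> _ Qac bqa n_gt0 [gl _].
have pow x : cluster_root e n x -> exists M : rmodule A, forall m : int,
    cluster_vec e M (mxpowz (coxeter e n) m *m x) \/
    cluster_vec e M ((-1) ^+ n *: (mxpowz (coxeter e n) m *m x)).
  move=> [X [M CT [Xi XM]] ->]; exists M.
  apply: (cluster_vec_pow Qac bqa n_gt0 gl CT).
  by exists X => //; split=> //; apply: summand_in_add.
split=> [x /pow[M xM] m|n_even x /pow[M xM] m].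
  have [/cluster_vec_ge0|/cluster_vec_ge0] := xM m; first by left.
  rewrite -signr_odd; case: odd => /= x_ge0 ; [right|left] => i; have := x_ge0 i.
    by rewrite expr1 scaleN1r mxE oppr_ge0.
  by rewrite expr0 scale1r.
have [/cluster_vec_ge0 //|/cluster_vec_ge0] := xM m.
by rewrite -signr_odd (negPf n_even) expr0 scale1r.
Qed.
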